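(* Let $\Phi=\sum_J\Phi_JE_J\in\mathrm V(\{s_a\})$ be a solution, of weight $\{s_a\}$, of the quantum Knizhnik–Zamolodchikov (qKZ) equations $p_i\Phi=K^{(q)}_i\Phi$, $i=1,\dots,N$. Then the function $$\Upsilon=\langle E^\hbar,\Phi\rangle=\sum_J\hbar^{\frac{\ell(J)}2}\Phi_J$$ is an eigenfunction of the trigonometric Ruijsenaars–Schneider Hamiltonians $\widehat H_d=\hbar^{\frac d2}\,T_d\big|_{t=\hbar^{-1}}$, where $$T_d=\sum_{\mathcal I\subset\{1,\dots,N\},\ |\mathcal I|=d}\ \prod_{i\in\mathcal I,\ j\notin\mathcal I}\frac{t\,a_i-a_j}{a_i-a_j}\ \prod_{i\in\mathcal I}p_i .$$
   Context: Here $N=\mathbf w_{n-1}$ is the number of sites, $a_1,\dots,a_N$ are the evaluation (equivariant) parameters, $\hbar,q$ are parameters, and $p_i$ is the shift operator $p_if(\dots,a_i,\dots)=f(\dots,qa_i,\dots)$. $\mathrm V=V(a_1)\otimes\dots\otimes V(a_N)$, where $V(a)$ is the $n$-dimensional evaluation representation of $U_\hbar(\widehat{\mathfrak{gl}}_n)$ with basis $e_1,\dots,e_n$; $e_{ab}$ are the matrix units. For $J=(j_1,\dots,j_N)$, $1\le j_k\le n$, put $E_J=e_{j_1}\otimes\dots\otimes e_{j_N}$. $\mathrm V(\{s_a\})$ is the weight subspace on which $S_a=\sum_{k=1}^Ne_{aa}^{(k)}$ has eigenvalue $s_a$ for $a=1,\dots,n$ (so it is spanned by the $E_J$ in which each $a$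 occurs $s_a$ times). $\ell(J)$ is the minimal number of (adjacent) permutations required to put the tuple $J$ into nondecreasing order. $E^\hbar=\sum_J\hbar^{\ell(J)/2}E_J$, with $J$ running over the multi-indices of weight $\{s_a\}$, and $\langle\cdot,\cdot\rangle$ is the bilinear form for which the $E_J$ are orthonormal. The trigonometric R-matrix is $$R(x)=\sum_{a=1}^ne_{aa}\otimes e_{aa}+\frac{x-x^{-1}}{\hbar^{\frac12}x-\hbar^{-\frac12}x^{-1}}\sum_{a\ne b}e_{aa}\otimes e_{bb}+\frac{\hbar^{\frac12}-\hbar^{-\frac12}}{\hbar^{\frac12}x-\hbar^{-\frac12}x^{-1}}\sum_{a<b}\big(x\,e_{ab}\otimes e_{ba}+x^{-1}e_{ba}\otimes e_{ab}\big),$$ and $R_{ij}(x)$ acts in the $i$-th and $j$-th sites of $\mathrm V$. $Z^{(i)}$ is the diagonal matrix $\mathrm{diag}(\zeta_1,\dots,\zeta_n)$ acting on the $i$-th site. The qKZ operators are $$K_i^{(q)}=R_{i\,i-1}\Big(\frac{a_iq}{a_{i-1}}\Big)\cdots R_{i\,1}\Big(\frac{a_iq}{a_1}\Big)\,Z^{(i)}\,R_{i\,N}\Big(\frac{a_i}{a_N}\Big)\cdots R_{i\,i+1}\Big(\frac{a_i}{a_{i+1}}\Big).$$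
   Formalization: The printed claim fails (N=n=2, weight (1,1), d=1): R(a_i/a_j) depends on a_i²/a_j². In the coefficients of T_d, a_i is replaced by a_i^{-2} (t=ħ^{-1} and the shifts p_i are kept). ''Eigenfunction'' means H_dΥ=EΥ with E constant; Υ=0 is allowed, since it can occur. *)

(* Defs.v *)
From HB Require Import structures.
From mathcomp Require Import all_boot all_order all_algebra perm.
From mathcomp Require Import reals complex.

Set Implicit Arguments.
Unset Strict Implicit.
Unset Printing Implicit Defensive.

Import GRing.Theory.
Local Open Scope ring_scope.

(* Sites are 'I_N and basis vectors of a site are 'I_n, both counted from 0.
   A multi-index J gives E_J; a vector of the tensor product is the family of
   its components on the E_J. *)
Definition multi_index (n N : nat) := {ffun 'I_N -> 'I_n}.
Definition tensor (F : fieldType) (n N : nat) := {ffun multi_index n N -> F^o}.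
Definition point (F : fieldType) (N : nat) := {ffun 'I_N -> F}.

Section MultiIndices.
Variables n N : nat.
Implicit Types J : multi_index n N.

Definition subst_site J (k : 'I_N) (b : 'I_n) : multi_index n N :=
  [ffun l => if l == k then b else J l].

Definition swap_sites J (k l : 'I_N) : multi_index n N :=
  [ffun m => J (tperm k l m)].

Definition nondecreasing_index J : bool :=
  [forall k : 'I_N, forall l : 'I_N, (k <= l)%N ==> (J k <= J l)%N].

(* J can be put into nondecreasing order by exactly m adjacent
   transpositions. *)
Fixpoint sortable_in (m : nat) J : bool :=
  if m is m'.+1 then
    [exists k : 'I_N, exists l : 'I_N,
       (l == k.+1 :> nat) && sortable_in m' (swap_sites J k l)]
  else nondecreasing_index J.

(* A swap at an adjacent descent increases this quantity, so that sorting
   terminates. *)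
Let moment J : nat := \sum_(k < N) k * J k.

Lemma moment_bound J : (moment J <= N * (N * n))%N.
Proof.
rewrite /moment; apply: leq_trans (_ : \sum_(k < N) (N * n) <= _)%N.
  by apply: leq_sum => k _; apply: leq_mul; apply: ltnW.
by rewrite sum_nat_const card_ord.
Qed.

Lemma moment_swap J (k l : 'I_N) :
  l = k.+1 :> nat -> (J l < J k)%N -> (moment J < moment (swap_sites J k l))%N.
Proof.
move=> lk ltJ; have nlk : l != k by rewrite -val_eqE /= lk gtn_eqF.
rewrite /moment (bigD1 k) //= (bigD1 l) //= [X in (_ < X)%N](bigD1 k) //=.
rewrite [X in (_ < _ + X)%N](bigD1 l) //= !ffunE tpermL tpermR !addnA.
rewrite [X in (_ < _ + X)%N](eq_bigr (fun i : 'I_N => (i * J i)%N)); last first.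
  by move=> i /andP[ik il]; rewrite ffunE tpermD // eq_sym.
rewrite ltn_add2r lk !mulSn.
by rewrite addnCA [X in (_ < X)%N]addnCA [X in (_ < _ + X)%N]addnC ltn_add2r.
Qed.

Lemma sortable_ex J : exists m, sortable_in m J.
Proof.
have [b] := ubnP (N * (N * n) - moment J)%N; elim: b J => // b IHb J leb.
have [sJ | nsJ] := boolP (nondecreasing_index J); first by exists 0%N.
have [/existsP[k /existsP[l /andP[/eqP lk ltJ]]] | noD] :=
  boolP [exists k : 'I_N, exists l : 'I_N, (l == k.+1 :> nat) && (J l < J k)%N].
  have [|m hm] := IHb (swap_sites J k l).
    rewrite ltnS in leb; apply: leq_trans leb.
    have h1 := moment_swap lk ltJ; have h2 := moment_bound (swap_sites J k l).
    by apply: ltn_sub2l => //; apply: leq_trans h1 h2.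
  by exists m.+1; apply/existsP; exists k; apply/existsP; exists l; rewrite lk eqxx.
case/negP: nsJ; apply/forallP=> k; apply/forallP=> l; apply/implyP.
suff H m (lt_m : (m < N)%N) : (k <= m)%N -> (J k <= J (Ordinal lt_m))%N.
  by move=> kl; have := H l (ltn_ord l) kl; congr (_ <= J _)%N; apply: val_inj.
elim: m lt_m => [|m IHm] lt_m.
  by rewrite leqn0 => /eqP k0; rewrite (_ : Ordinal lt_m = k) //; apply: val_inj.
rewrite leq_eqVlt => /orP[/eqP km | km].
  by rewrite (_ : Ordinal lt_m = k) //; apply: val_inj.
apply: leq_trans (IHm (ltnW lt_m) km) _; rewrite leqNgt.
apply: contra noD => ltJ; apply/existsP; exists (Ordinal (ltnW lt_m)).
by apply/existsP; exists (Ordinal lt_m); rewrite eqxx.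
Qed.

Definition ell J : nat := ex_minn (sortable_ex J).

Definition of_weight (s : 'I_n -> nat) J : bool :=
  [forall c, #|[set k | J k == c]| == s c].

End MultiIndices.

Section Operators.
Variables (F : fieldType) (n N : nat).
(* hh is a chosen square root of hbar. *)
Variables (hh q : F) (zeta : 'I_n -> F).
Local Notation V := (tensor F n N).
Local Notation pt := (point F N).
Implicit Types (v : V) (a : pt) (f : pt -> F).

Definition basis_vec (J : multi_index n N) : V := [ffun K => (K == J)%:R].

Definition pairing (u v : V) : F := \sum_J u J * v J.

(* e_{bc} acting on site k: it sends E_J to E_{J with J_k := b} when J_k = c,
   and to 0 otherwise. *)
Definition munit (b c : 'I_n) (k : 'I_N) v : V :=
  [ffun J : multi_index n N => if J k == b then v (subst_site J k c) else 0].

Definition weight_space (s : 'I_n -> nat) v : Prop :=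
  forall c : 'I_n, \sum_(k < N) munit c c k v = (s c)%:R *: v.

Definition Rmat (i j : 'I_N) (x : F) v : V :=
  let D := hh * x - hh^-1 * x^-1 in
  \sum_(b < n) munit b b i (munit b b j v)
  + ((x - x^-1) / D) *:
      \sum_(b < n) \sum_(c < n | b != c) munit b b i (munit c c j v)
  + ((hh - hh^-1) / D) *:
      \sum_(b < n) \sum_(c < n | (b < c)%N)
        (x *: munit b c i (munit c b j v) + x^-1 *: munit c b i (munit b c j v)).

Definition Zmat (i : 'I_N) v : V := \sum_(b < n) zeta b *: munit b b i v.

(* op_prod [:: j1; ...; jm] A is A j1 \o ... \o A jm. *)
Definition op_prod (js : seq 'I_N) (A : 'I_N -> V -> V) v : V := foldr A v js.

Definition qKZ_op (a : pt) (i : 'I_N) v : V :=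
  op_prod (rev [seq j : 'I_N <- enum 'I_N | (j < i)%N])
    (fun j => Rmat i j (a i * q / a j))
    (Zmat i
      (op_prod (rev [seq j : 'I_N <- enum 'I_N | (i < j)%N])
        (fun j => Rmat i j (a i / a j)) v)).

(* f (qshift I a) is the value at a of (\prod_(i in I) p_i) f. *)
Definition qshift (I : {set 'I_N}) a : pt :=
  [ffun i => if i \in I then q * a i else a i].

Definition qKZ_solution (D : pt -> Prop) (Phi : pt -> V) : Prop :=
  forall a, D a -> forall i, Phi (qshift [set i] a) = qKZ_op a i (Phi a).

(* Functions of a_1, ..., a_N live on a region which the shifts p_i preserve
   and which avoids the poles of the R-matrices and of the Hamiltonians. *)
Definition regular_region (D : pt -> Prop) : Prop :=
  [/\ forall a, D a -> forall i, a i != 0,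
      forall a, D a -> forall i j, i != j ->
        a i ^+ 2 != a j ^+ 2 /\ hh ^+ 2 * a i ^+ 2 != a j ^+ 2
    & forall a, D a -> forall i, D (qshift [set i] a)].

Definition Ehbar (s : 'I_n -> nat) : V :=
  \sum_(J | of_weight s J) hh ^+ ell J *: basis_vec J.

Definition Upsilon (s : 'I_n -> nat) (Phi : pt -> V) a : F :=
  pairing (Ehbar s) (Phi a).

(* T_d with its coefficients evaluated at the positions u a. *)
Definition tRS_T (u : pt -> pt) (t : F) (d : nat) f a : F :=
  \sum_(I : {set 'I_N} | #|I| == d)
    (\prod_(i in I) \prod_(j in ~: I)
       ((t * u a i - u a j) / (u a i - u a j))) * f (qshift I a).

Definition tRS_H (u : pt -> pt) (d : nat) f a : F :=
  hh ^+ d * tRS_T u (hh ^+ 2)^-1 d f a.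

(* The R-matrix depends on its argument x only through x^2, and its entry
     (x - x^-1) / (hh x - hh^-1 x^-1),  x = a_i / a_j,
   must cancel the coefficient of p_i in H_1, which is proportional to
   (u_i - hbar u_j) / (u_i - u_j). This forces u_i / u_j = (a_i / a_j)^-2: the
   particle positions are the a_i^-2, which p_i multiplies by q^-2. With
   u_i = a_i the eigenfunction property fails already for N = n = 2 and weight
   (1, 1). *)
Definition tRS_position a : pt := [ffun i => (a i ^+ 2)^-1].

(* The eigenvalue is a constant; f = 0 is not excluded. *)
Definition eigenfunction (D : pt -> Prop) (H : (pt -> F) -> pt -> F) f : Prop :=
  exists E : F, forall a, D a -> H f a = E * f a.

End Operators.

(* Main.v *)
Require Import Defs.
From mathcomp Require Import all_boot all_order all_algebra perm.
From mathcomp Require Import ring zify.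
From mathcomp Require Import reals complex.

(* Put u_i = a_i^-2 and let eps be the functional with eps (E_J) = hh ^+ ell J.
   The braid-form R-matrices fix eps, so they can be removed one after another
   from <eps, K_(i_d) ... K_(i_1) Phi>; in what remains the shift q has
   disappeared, and <eps, Phi (q_I a)> = <flat_I (u), Phi a>, where flat_I is the
   solution of the exchange relations with R-matrices that is constant on the
   chamber in which the sites of I come last. The numerator
     numer (u) = \prod_(i < j) (u_j - u_i) *
       \sum_I \prod_(i in I, j notin I) (...) flat_I (u)
   is a polynomial of degree < N in each u_i, and its exchange relation forces it
   to vanish when u_i = u_j. Hence it is a constant functional times the
   Vandermonde product, and a constant functional that satisfies the exchange
   relations is proportional to eps on each weight space. *)

Set Implicit Arguments.
Unset Strict Implicit.
Unset Printing Implicit Defensive.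

Import GRing.Theory Num.Theory.
Local Open Scope ring_scope.

(** * The Yang-Baxter relation on functionals *)

(** A word [M] marks the sites whose shift has already been absorbed into the functional. Applied to
    a functional, [K_i] carries the unmarked site i down to the first place; there the twist marks
    it and puts it at the last place, from which it returns to its own. An unmarked site at the
    first place and a marked site at the last place take part in no inversion of the word, so the
    functional does not depend on the position there. Exactly at this moment the shifted position is
    replaced by the unshifted one, and q leaves no trace. The coefficients of the Hamiltonians fit
    these functionals: for i < j with [M i] and [~~ M j], the numerator [dd (u i) (u j)] is the very
    denominator that the R-matrices introduce. Only the differences u_j - u_i survive as poles, and
    after clearing them each pair of sites contributes degree at most one. *)

Definition pull (N : nat) (T : Type) (c : 'I_N -> 'I_N) (f : {ffun 'I_N -> T}) :
  {ffun 'I_N -> T} := [ffun m => f (c m)].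

Lemma pull_pull (N : nat) (T : Type) (c e : 'I_N -> 'I_N) (f : {ffun 'I_N -> T}) :
  pull c (pull e f) = pull (e \o c) f.
Proof. by apply/ffunP => m; rewrite !ffunE. Qed.

Lemma eq_pull (N : nat) (T : Type) (c e : 'I_N -> 'I_N) (f : {ffun 'I_N -> T}) :
  c =1 e -> pull c f = pull e f.
Proof. by move=> ce; apply/ffunP => m; rewrite !ffunE ce. Qed.

Lemma pull_id (N : nat) (T : Type) (c : 'I_N -> 'I_N) (f : {ffun 'I_N -> T}) :
  c =1 id -> pull c f = f.
Proof. by move=> ce; apply/ffunP => m; rewrite !ffunE ce. Qed.

Lemma pull_tpermK (N : nat) (T : Type) (k l : 'I_N) :
  involutive (@pull N T (tperm k l)).
Proof. by move=> f; rewrite pull_pull pull_id // => m /=; rewrite tpermK. Qed.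

Lemma tperm_if (T : finType) (x y z : T) :
  tperm x y z = if z == x then y else if z == y then x else z.
Proof. by case: tpermP => [->|->|/eqP/negPf -> /eqP/negPf ->]; rewrite ?eqxx //; case: eqP. Qed.

Lemma pull_tperm_braid (N : nat) (T : Type) (k l m : 'I_N) (f : {ffun 'I_N -> T}) :
  k != l -> k != m -> l != m ->
  pull (tperm l m) (pull (tperm k l) (pull (tperm l m) f)) =
  pull (tperm k l) (pull (tperm l m) (pull (tperm k l) f)).
Proof.
move=> kl km lm; apply/ffunP => z; rewrite !ffunE; congr (f _).
have [lk mk ml] : [/\ l != k, m != k & m != l] by split; rewrite eq_sym.
pose neqs := (negPf kl, negPf km, negPf lm, negPf lk, negPf mk, negPf ml).
rewrite !tperm_if.
have [e|/negPf zk] := eqVneq z k; first by rewrite ?e !(eqxx, neqs).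
have [e|/negPf zl] := eqVneq z l; first by rewrite ?e !(eqxx, neqs).
have [e|/negPf zm] := eqVneq z m; first by rewrite ?e !(eqxx, neqs).
by rewrite !(zk, zl, zm).
Qed.

Lemma pull_tperm_comm (N : nat) (T : Type) (k l k' l' : 'I_N) (f : {ffun 'I_N -> T}) :
  k != k' -> k != l' -> l != k' -> l != l' ->
  pull (tperm k l) (pull (tperm k' l') f) = pull (tperm k' l') (pull (tperm k l) f).
Proof.
move=> kk kl lk ll; rewrite !pull_pull; apply: eq_pull => m /=.
case: (tpermP k' l' m) => [->|->|/eqP m1 /eqP m2].
- by rewrite [tperm k l k']tpermD ?tpermL // 1?eq_sym // [tperm k l l']tpermD.
- by rewrite [tperm k l l']tpermD ?tpermR // 1?eq_sym // [tperm k l k']tpermD.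
- by case: (tpermP k l m) => [_|_|/eqP m3 /eqP m4]; rewrite tpermD // eq_sym.
Qed.

Lemma pull_tperm_eq (N : nat) (T : Type) (k l : 'I_N) (f : {ffun 'I_N -> T}) :
  f k = f l -> pull (tperm k l) f = f.
Proof. by move=> fkl; apply/ffunP => m; rewrite ffunE; case: tpermP => [->|->|//]. Qed.

Lemma adjacent_neq (N : nat) (k l : 'I_N) : l = k.+1 :> nat -> k != l.
Proof. by move=> lk; rewrite -val_eqE /= lk; lia. Qed.

(** * Products over pairs of sites under an adjacent transposition *)

Section PairProducts.
Variables (N : nat) (S : Type) (idx : S) (op : Monoid.com_law idx).

Lemma big_pairD1 (X : 'I_N -> 'I_N -> S) (k l : 'I_N) : l = k.+1 :> nat ->
  \big[op/idx]_(p : 'I_N * 'I_N | (p.1 < p.2)%N) X p.1 p.2 =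
  op (X k l) (\big[op/idx]_(p : 'I_N * 'I_N | (p.1 < p.2)%N && (p != (k, l)))
    X p.1 p.2).
Proof. by move=> lk; rewrite (bigD1 (k, l)) //= lk. Qed.

(** An adjacent transposition preserves the order of every pair of sites except (k, l), so only that
    factor is reversed. *)
Lemma big_pair_swap (X : 'I_N -> 'I_N -> S) (k l : 'I_N) : l = k.+1 :> nat ->
  \big[op/idx]_(p : 'I_N * 'I_N | (p.1 < p.2)%N)
    X (tperm k l p.1) (tperm k l p.2) =
  op (X l k) (\big[op/idx]_(p : 'I_N * 'I_N | (p.1 < p.2)%N && (p != (k, l)))
    X p.1 p.2).
Proof.
move=> lk; rewrite (bigD1 (k, l)) /= ?lk // tpermL tpermR; congr (op _ _).
rewrite [RHS](reindex_inj (h := fun p => (tperm k l p.1, tperm k l p.2))) /=; last first.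
  by move=> [a b] [a' b'] /= [/perm_inj -> /perm_inj ->].
apply: eq_bigl => -[a b] /=; rewrite !xpair_eqE -!val_eqE /=.
by case: tpermP => [->|->|/eqP + /eqP +]; case: tpermP => [->|->|/eqP + /eqP +];
  rewrite -?val_eqE /=; lia.
Qed.

End PairProducts.

Section YangBaxter.
Variables (F : fieldType) (n N : nat) (hh : F).
Hypothesis hh0 : hh != 0.
Local Notation idx := (multi_index n N).
Local Notation fn := {ffun multi_index n N -> F}.
Implicit Types (g : fn) (J : idx).

Definition exch_den (v w : F) : F := hh * w - hh^-1 * v.
Definition exch_cst : F := hh - hh^-1.
Local Notation dd := exch_den.
Local Notation cc := exch_cst.

(* dd v w times the right action of the braid-form R-matrix P R(x), with
   x^2 = w / v, on row vectors. *)
Definition exch (k l : 'I_N) (v w : F) g : fn :=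
  [ffun J : idx => if J k == J l then dd v w * g J
    else (w - v) * g (pull (tperm k l) J)
         + cc * (if (J l < J k)%N then w else v) * g J].
Local Notation yop := exch.

Definition scl (a : F) g : fn := [ffun J => a * g J].

Lemma exchZ k l v w a g : yop k l v w (scl a g) = scl a (yop k l v w g).
Proof. by apply/ffunP => J; rewrite !ffunE; case: ifP => _; ring. Qed.

Lemma exch_sum k l v w (I : finType) (P : pred I) (g : I -> fn) :
  yop k l v w (\sum_(i | P i) g i) = \sum_(i | P i) yop k l v w (g i).
Proof.
apply/ffunP => J; rewrite !ffunE !sum_ffunE.
under [in RHS]eq_bigr do rewrite ffunE.
by case: ifP => _; rewrite !mulr_sumr // -big_split.
Qed.

(** At v = w the R-matrix degenerates to the permutation, so its braid form is a scalar. *)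
Lemma exch_diag k l v g : yop k l v v g = scl (cc * v) g.
Proof.
by apply/ffunP => J; rewrite !ffunE if_same /dd /cc; case: (_ == _); ring.
Qed.

Lemma exch_unitarity k l v w g : k != l ->
  yop k l v w (yop k l w v g) = scl (dd v w * dd w v) g.
Proof.
move=> kl; apply/ffunP => J; rewrite !ffunE pull_tpermK tpermL tpermR.
rewrite [J l == J k]eq_sym; case: (boolP (J k == J l)) => [_|]; first by rewrite mulrA.
rewrite -val_eqE /= /dd /cc => /eqP ne; case: (ltngtP (J k) (J l)) ne => // _ _; field; exact: hh0.
Qed.

Lemma exch_comm k l k' l' v w v' w' g :
  k != k' -> k != l' -> l != k' -> l != l' ->
  yop k l v w (yop k' l' v' w' g) = yop k' l' v' w' (yop k l v w g).
Proof.
move=> kk kl lk ll; apply/ffunP => J; rewrite !ffunE.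
rewrite ![tperm k l _]tpermD ?[tperm k' l' _]tpermD //; try by rewrite eq_sym.
rewrite (@pull_tperm_comm _ _ k l k' l') //.
by case: ifP => _; case: ifP => _; ring.
Qed.

(** The braid relation sees only the letters at k, l, m. Exposing them as arguments turns both sides
    into rational expressions indexed by the relative order of three letters. *)
Let put3 k l m J p q r : idx :=
  [ffun z => if z == k then p else if z == l then q else if z == m then r else J z].

Lemma exch_braid k l m a b c g : k != l -> k != m -> l != m ->
  yop k l a b (yop l m a c (yop k l b c g)) =
  yop l m b c (yop k l a c (yop l m a b g)).
Proof.
move=> kl km lm; apply/ffunP => J.
have sw1 p q r : pull (tperm k l) (put3 k l m J p q r) = put3 k l m J q p r.
  apply/ffunP => z; rewrite !ffunE; case: tpermP => [->|->|/eqP z1 /eqP z2].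
  - by rewrite eqxx [l == k]eq_sym (negPf kl) eqxx.
  - by rewrite eqxx [l == k]eq_sym (negPf kl) eqxx.
  - by rewrite (negPf z1) (negPf z2).
have sw2 p q r : pull (tperm l m) (put3 k l m J p q r) = put3 k l m J p r q.
  apply/ffunP => z; rewrite !ffunE; case: tpermP => [->|->|/eqP z1 /eqP z2].
  - by rewrite eqxx [m == k]eq_sym [l == k]eq_sym [m == l]eq_sym (negPf lm) (negPf kl) (negPf km) eqxx.
  - by rewrite eqxx [m == k]eq_sym [l == k]eq_sym [m == l]eq_sym (negPf lm) (negPf kl) (negPf km) eqxx.
  - by rewrite (negPf z1) (negPf z2).
have Y1 v w f p q r : yop k l v w f (put3 k l m J p q r) =
    if p == q then dd v w * f (put3 k l m J p q r)
    else (w - v) * f (put3 k l m J q p r)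
      + cc * (if (q < p)%N then w else v) * f (put3 k l m J p q r).
  by rewrite ffunE sw1 !(ffunE, eqxx) [l == k]eq_sym (negPf kl).
have Y2 v w f p q r : yop l m v w f (put3 k l m J p q r) =
    if q == r then dd v w * f (put3 k l m J p q r)
    else (w - v) * f (put3 k l m J p r q)
      + cc * (if (r < q)%N then w else v) * f (put3 k l m J p q r).
  by rewrite ffunE sw2 !(ffunE, eqxx) [l == k]eq_sym [m == k]eq_sym [m == l]eq_sym
    (negPf kl) (negPf km) (negPf lm).
have -> : J = put3 k l m J (J k) (J l) (J m).
  by apply/ffunP => z; rewrite ffunE; do 3! [case: eqP => [-> //|_]].
move: (J k) (J l) (J m) => p q r.
have cmp (x y : 'I_n) : (x == y) = (nat_of_ord x == y) by [].
have [pq|pq|/ord_inj pq] := ltngtP p q; have [qr|qr|/ord_inj qr] := ltngtP q r;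
  have [pr|pr|/ord_inj pr] := ltngtP p r; subst; try (by exfalso; lia);
  rewrite !(Y1, Y2) !cmp ?eqxx;
  repeat (match goal with |- context [(nat_of_ord ?x == nat_of_ord ?y)] =>
    first [rewrite (_ : (nat_of_ord x == nat_of_ord y) = false); last by lia] end);
  repeat (match goal with |- context [(nat_of_ord ?x < nat_of_ord ?y)%N] =>
    first [rewrite (_ : (nat_of_ord x < nat_of_ord y)%N = false); last by lia
          |rewrite (_ : (nat_of_ord x < nat_of_ord y)%N = true); last by lia] end);
  rewrite /dd /cc; field; exact: hh0.
Qed.

End YangBaxter.

(** * Flat sections *)

Section FlatSections.
Variables (F : fieldType) (n N : nat) (hh : F) (zeta : 'I_n -> F).
Hypothesis hh0 : hh != 0.
Local Notation idx := (multi_index n N).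
Local Notation fn := {ffun multi_index n N -> F}.
Local Notation word := {ffun 'I_N -> bool}.
Local Notation pt := (point F N).
Local Notation dd := (exch_den hh).
Local Notation cc := (exch_cst hh).
Local Notation yop := (exch hh).
Implicit Types (g : fn) (J : idx) (M : word) (u : pt).

(* Inversion of the letters a, b at sites i < j, in the order of the sites that
   puts the sites selected by M first. *)
Definition theta (mi mj : bool) (a b : 'I_n) : bool :=
  if ~~ mi && mj then (a < b)%N else (b < a)%N.

Definition base M : fn :=
  [ffun J : idx => (\prod_m (if M m then zeta (J m) else 1)) *
    \prod_(p : 'I_N * 'I_N | (p.1 < p.2)%N)
      hh ^+ theta (M p.1) (M p.2) (J p.1) (J p.2)].

(** In the order behind [theta], adjacent sites with the same mark remain consecutive. Everything
    therefore reduces to the two-letter identity hh (w - v) + (hh - hh^-1) v = [dd v w] and its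
    mirror image. *)
Lemma base_exch M (k l : 'I_N) v w : l = k.+1 :> nat -> M k = M l ->
  yop k l v w (base M) = scl (dd v w) (base M).
Proof.
move=> lk Mkl; apply/ffunP => J; rewrite !ffunE.
case: (eqVneq (J k) (J l)) => [//|Jkl].
set z1 := \prod_m _; set z2 := \prod_m _.
have -> : z1 = z2.
  rewrite /z1 (reindex_inj (@perm_inj _ (tperm k l))) /=.
  apply: eq_bigr => m _; rewrite ffunE tpermK.
  by case: tpermP => [->|->|//]; rewrite Mkl.
pose X i j := hh ^+ theta (M i) (M j) (J i) (J j).
rewrite (big_pairD1 _ X lk) (eq_bigr (fun p => X (tperm k l p.1) (tperm k l p.2))); last first.
  move=> p _; rewrite !ffunE; congr (hh ^+ theta _ _ _ _).
    by case: tpermP => [->|->|//]; rewrite Mkl.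
  by case: tpermP => [->|->|//]; rewrite Mkl.
rewrite (big_pair_swap _ X lk) /=; set r := (\big[_/_]_(_ | _) _).
rewrite /X /theta Mkl andNb /exch_den /exch_cst.
move: Jkl; rewrite -val_eqE /= => /eqP.
by case: ltngtP => // _ _; rewrite /= ?expr1 ?expr0; field; exact: hh0.
Qed.

Definition minv M : nat :=
  \sum_(p : 'I_N * 'I_N | (p.1 < p.2)%N) (M p.1 && ~~ M p.2).

Lemma minv_swap M (k l : 'I_N) : l = k.+1 :> nat -> M k -> ~~ M l ->
  minv M = (minv (pull (tperm k l) M)).+1.
Proof.
move=> lk Mk Ml; pose X i j := nat_of_bool (M i && ~~ M j).
rewrite /minv (big_pairD1 _ X lk) /= [X k l]/X Mk Ml /= add1n; congr _.+1.
rewrite [RHS](eq_bigr (fun p => X (tperm k l p.1) (tperm k l p.2))); last first.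
  by move=> p _; rewrite !ffunE.
by rewrite (big_pair_swap _ X lk) /= [X l k]/X (negPf Ml) add0n.
Qed.

Definition descent M (p : 'I_N * 'I_N) : bool :=
  [&& p.2 == p.1.+1 :> nat, M p.1 & ~~ M p.2].

(** Each exchange removes one inversion of the word, so [minv M] is enough fuel. The descent picked
    is arbitrary; [psi_step] shows that the choice is immaterial. *)
Fixpoint psi_rec m M u : fn :=
  if m is m'.+1 then
    if [pick p | descent M p] is Some p then
      yop p.1 p.2 (u p.1) (u p.2)
        (psi_rec m' (pull (tperm p.1 p.2) M) (pull (tperm p.1 p.2) u))
    else base M
  else base M.

(* Up to the factor \prod_(i < j, M i, ~~ M j) dd (u i) (u j), this is the
   solution of the exchange relations with R-matrices that takes the constant
   value base at the words of the form 0...01...1. *)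
Definition psi M u : fn := psi_rec (minv M) M u.

Lemma psi_base M u : (forall p, ~~ descent M p) -> psi M u = base M.
Proof.
move=> noD; rewrite /psi; case: (minv M) => //= m.
by case: pickP => // p; rewrite (negPf (noD p)).
Qed.

Lemma descent_disjoint M (k l k' l' : 'I_N) : descent M (k, l) -> descent M (k', l') ->
  (k, l) <> (k', l') -> [/\ k != k', k != l', l != k' & l != l'].
Proof.
move=> /and3P[/= /eqP lk Mk Ml] /and3P[/= /eqP lk' Mk' Ml'] ne.
have kk' : k != k'.
  apply/eqP => e; apply: ne; congr (_, _) => //; apply: val_inj => /=.
  by rewrite lk lk' e.
split=> //.
- by apply: contraNneq Ml' => <-.
- by apply: contraNneq Ml => ->.
- by apply: contraNneq kk' => e; apply/eqP/val_inj => /=; move: lk; rewrite e lk' => -[].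
Qed.

(** Two distinct descents of a two-letter word never share a site, so independence of the choice
    needs only the commutation of exchanges at disjoint sites. *)
Lemma psi_step M u (k l : 'I_N) : descent M (k, l) ->
  psi M u = yop k l (u k) (u l) (psi (pull (tperm k l) M) (pull (tperm k l) u)).
Proof.
have [b] := ubnP (minv M); elim: b M u k l => // b IHb M u k l lb dM.
have /and3P[/= /eqP lk Mk Ml] := dM.
have mM := minv_swap lk Mk Ml.
rewrite {1}/psi mM /=; case: pickP => [[k' l'] dM'|/(_ (k, l))]; last by rewrite dM.
have /and3P[/= /eqP lk' Mk' Ml'] := dM'.
have mM' := minv_swap lk' Mk' Ml'.
have -> : minv (pull (tperm k l) M) = minv (pull (tperm k' l') M).
  by apply: succn_inj; rewrite -mM -mM'.
rewrite -/(psi _ _) /=.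
case: (eqVneq (k, l) (k', l')) => [[-> ->] //|/eqP ne].
have [kk kl' lk2 ll] := descent_disjoint dM dM' ne.
have lt : (minv (pull (tperm k l) M) < b)%N by move: lb; rewrite mM ltnS.
have lt' : (minv (pull (tperm k' l') M) < b)%N by move: lb; rewrite mM' ltnS.
have d1 : descent (pull (tperm k' l') M) (k, l).
  by rewrite /descent /= !ffunE !tpermD // 1?eq_sym //; apply/and3P; rewrite lk.
have d2 : descent (pull (tperm k l) M) (k', l').
  by rewrite /descent /= !ffunE !tpermD // 1?eq_sym //; apply/and3P; rewrite lk'.
rewrite (IHb _ _ _ _ lt' d1) (IHb _ _ _ _ lt d2) !ffunE !tpermD // 1?eq_sym //.
rewrite (@exch_comm _ _ _ _ k l k' l') //.
by rewrite !(@pull_tperm_comm _ _ k' l' k l) // eq_sym.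
Qed.

(** Induction along a descent, with [base_exch] at the words that have none. A descent disjoint from
    (k, l) commutes with the exchange. If they share a site, a third letter crosses both equal
    letters, and the Yang-Baxter relation carries the exchange past the two crossings. *)
Lemma psi_same M u (k l : 'I_N) : l = k.+1 :> nat -> M k = M l ->
  scl (dd (u k) (u l)) (psi M u) = yop k l (u k) (u l) (psi M (pull (tperm k l) u)).
Proof.
have [b] := ubnP (minv M); elim: b M u k l => // b IHb M u k l lb lk Mkl.
have [[a c] dM|noD] := pickP (descent M); last first.
  by rewrite !psi_base ?base_exch // => p; rewrite noD.
have /and3P[/= /eqP ca Ma Mc] := dM.
have mM := minv_swap ca Ma Mc.
have kl := adjacent_neq lk; have ac := adjacent_neq ca.
have [al|al] := eqVneq a l.
  (* The letters at k, l, c are 1, 1, 0. The 0 crosses both, after which the equal letters stand at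
     l and c. *)
  subst a; have Mk : M k by rewrite Mkl.
  have kc : k != c by rewrite -val_eqE /= ca lk; lia.
  set M1 := pull (tperm l c) M.
  have d1 : descent M1 (k, l).
    by rewrite /descent /= !ffunE tpermL tpermD // 1?eq_sym // Mk Mc lk eqxx.
  have mM1 := minv_swap lk (proj1 (andP (proj2 (andP d1)))) (proj2 (andP (proj2 (andP d1)))).
  rewrite (psi_step u dM) -/M1 (psi_step _ d1) (psi_step (pull (tperm k l) u) dM) -/M1.
  have tk : tperm l c k = k by rewrite tpermD // eq_sym.
  have tc : tperm k l c = c by rewrite tpermD.
  rewrite (psi_step _ d1) !ffunE !(tpermL, tpermR, tk, tc).
  set M2 := pull (tperm k l) M1.
  rewrite -!exchZ.
  have lt2 : (minv M2 < b)%N by move: lb; rewrite mM -/M1 mM1 -/M2 ltnS; apply: ltnW.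
  have e2 : M2 l = M2 c.
    by rewrite !ffunE !(tpermL, tpermR, tk, tc).
  set u2 := pull (tperm k l) (pull (tperm l c) u).
  have := IHb M2 u2 l c lt2 ca e2.
  have -> : u2 l = u k by rewrite !ffunE !(tpermL, tpermR, tk, tc).
  have -> : u2 c = u l by rewrite !ffunE !(tpermL, tpermR, tk, tc).
  move=> ->; rewrite -exch_braid //; congr (yop _ _ _ _ (yop _ _ _ _ (yop _ _ _ _ (psi _ _)))).
  by rewrite /u2 pull_tperm_braid.
have [ck|ck] := eqVneq c k.
  (* The letters at a, k, l are 1, 0, 0. The 1 crosses both, after which the equal letters stand at
     a and k. *)
  subst c; have Ml : ~~ M l by rewrite -Mkl.
  have al' : a != l by rewrite -val_eqE /= lk ca; lia.
  set M1 := pull (tperm a k) M.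
  have d1 : descent M1 (k, l).
    by rewrite /descent /= !ffunE tpermR tpermD // Ma Ml lk eqxx.
  have mM1 := minv_swap lk (proj1 (andP (proj2 (andP d1)))) (proj2 (andP (proj2 (andP d1)))).
  rewrite (psi_step u dM) -/M1 (psi_step _ d1) (psi_step (pull (tperm k l) u) dM) -/M1.
  have tl : tperm a k l = l by rewrite tpermD.
  have ta : tperm k l a = a by rewrite tpermD // eq_sym.
  rewrite (psi_step _ d1) !ffunE !(tpermL, tpermR, tl, ta).
  set M2 := pull (tperm k l) M1.
  rewrite -!exchZ.
  have lt2 : (minv M2 < b)%N by move: lb; rewrite mM -/M1 mM1 -/M2 ltnS; apply: ltnW.
  have e2 : M2 a = M2 k.
    by rewrite !ffunE !(tpermL, tpermR, tl, ta).
  set u2 := pull (tperm k l) (pull (tperm a k) u).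
  have := IHb M2 u2 a k lt2 ca e2.
  have -> : u2 a = u k by rewrite !ffunE !(tpermL, tpermR, tl, ta).
  have -> : u2 k = u l by rewrite !ffunE !(tpermL, tpermR, tl, ta).
  move=> ->; rewrite exch_braid //; congr (yop _ _ _ _ (yop _ _ _ _ (yop _ _ _ _ (psi _ _)))).
  by rewrite /u2 pull_tperm_braid.
have ka : k != a by apply: contraNneq Mc => ka; rewrite -[c](_ : l = c) -?Mkl ?ka //; apply: val_inj; rewrite /= lk ca ka.
have lc : l != c by apply: contraNneq ka => e; apply/eqP/val_inj => /=; move: lk; rewrite e ca => -[].
rewrite (psi_step u dM) (psi_step (pull (tperm k l) u) dM) -exchZ.
rewrite !ffunE !(@tpermD _ k l) // 1?eq_sym //.
have [kc la] : k != c /\ l != a by split; rewrite eq_sym.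
rewrite (@exch_comm _ _ _ _ k l a c) //.
congr (yop _ _ _ _ _).
have lt1 : (minv (pull (tperm a c) M) < b)%N by move: lb; rewrite mM ltnS.
have := IHb _ (pull (tperm a c) u) k l lt1 lk.
rewrite !ffunE !(@tpermD _ a c) // 1?eq_sym // => /(_ Mkl) ->.
by congr (yop _ _ _ _ (psi _ _)); apply: pull_tperm_comm; rewrite // eq_sym.
Qed.

End FlatSections.

(** * The Vandermonde quotient is constant *)

Section PolynomialFunctions.
Variable F : fieldType.
Implicit Types f g : F -> F.

(** The argument varies one coordinate at a time, so degree bounds in a single variable replace
    multivariate polynomials. *)
Definition polyfun (e : nat) f : Prop :=
  exists2 p : {poly F}, (size p <= e.+1)%N & forall v, f v = p.[v].

Lemma eq_polyfun e f g : f =1 g -> polyfun e f -> polyfun e g.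
Proof. by move=> fg [p sp fp]; exists p => // v; rewrite -fg. Qed.

Lemma polyfunW e e' f : (e <= e')%N -> polyfun e f -> polyfun e' f.
Proof. by move=> le [p sp fp]; exists p => //; apply: leq_trans sp _. Qed.

Lemma polyfunC e c : polyfun e (fun=> c).
Proof.
by exists c%:P => [|v]; rewrite ?hornerC // size_polyC; case: (c != 0).
Qed.

Lemma polyfun_id : polyfun 1 id.
Proof. by exists 'X => [|v]; rewrite ?hornerX ?size_polyX. Qed.

Lemma polyfunD e f g : polyfun e f -> polyfun e g -> polyfun e (fun v => f v + g v).
Proof.
move=> [p sp fp] [q sq gq]; exists (p + q) => [|v]; last by rewrite hornerD fp gq.
by apply: leq_trans (size_polyD _ _) _; rewrite geq_max sp.
Qed.

Lemma polyfunM e e' f g : polyfun e f -> polyfun e' g ->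
  polyfun (e + e') (fun v => f v * g v).
Proof.
move=> [p sp fp] [q sq gq]; exists (p * q) => [|v]; last by rewrite hornerM fp gq.
by apply: leq_trans (size_polyMleq _ _) _; move: sp sq; lia.
Qed.

Lemma polyfunZ e c f : polyfun e f -> polyfun e (fun v => c * f v).
Proof. exact: (polyfunM (polyfunC 0 c)). Qed.

Lemma polyfunB e f g : polyfun e f -> polyfun e g -> polyfun e (fun v => f v - g v).
Proof.
move=> Pf Pg; apply: eq_polyfun (polyfunD Pf (polyfunZ (-1) Pg)) => v.
by rewrite mulN1r.
Qed.

Lemma polyfun_sum (I : Type) (r : seq I) (P : pred I) e (f : I -> F -> F) :
  (forall i, P i -> polyfun e (f i)) -> polyfun e (fun v => \sum_(i <- r | P i) f i v).
Proof.
move=> Pf; elim: r => [|i r IHr].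
  by apply: eq_polyfun (polyfunC e 0) => v; rewrite big_nil.
case Pi: (P i).
  by apply: eq_polyfun (polyfunD (Pf i Pi) IHr) => v; rewrite big_cons Pi.
by apply: eq_polyfun IHr => v; rewrite big_cons Pi.
Qed.

Lemma polyfun_prod (I : Type) (r : seq I) (P : pred I) (e : I -> nat) (f : I -> F -> F) :
  (forall i, P i -> polyfun (e i) (f i)) ->
  polyfun (\sum_(i <- r | P i) e i) (fun v => \prod_(i <- r | P i) f i v).
Proof.
move=> Pf; elim: r => [|i r IHr].
  by apply: eq_polyfun (polyfunC _ 1) => v; rewrite big_nil.
rewrite big_cons; case Pi: (P i).
  by apply: eq_polyfun (polyfunM (Pf i Pi) IHr) => v; rewrite big_cons Pi.
by apply: eq_polyfun IHr => v; rewrite big_cons Pi.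
Qed.

Lemma polyfun_eq0 e f (s : seq F) : polyfun e f -> uniq s -> (e < size s)%N ->
  {in s, forall v, f v = 0} -> forall v, f v = 0.
Proof.
move=> [p sp fp] us es f0 v; rewrite fp.
suff -> : p = 0 by rewrite horner0.
apply: (@roots_geq_poly_eq0 _ _ s) => //; last by apply: leq_trans sp es.
by apply/allP => z zs; rewrite /root -fp f0.
Qed.

End PolynomialFunctions.

Definition upd (F : fieldType) (N : nat) (u : point F N) (i : 'I_N) (v : F) : point F N :=
  [ffun j => if j == i then v else u j].

Lemma upd_same (F : fieldType) (N : nat) (u : point F N) i : upd u i (u i) = u.
Proof. by apply/ffunP => j; rewrite ffunE; case: eqP => [->|]. Qed.

Lemma pull_upd (F : fieldType) (N : nat) (u : point F N) (k l i : 'I_N) v :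
  pull (tperm k l) (upd u i v) = upd (pull (tperm k l) u) (tperm k l i) v.
Proof.
by apply/ffunP => j; rewrite !ffunE (can2_eq (tpermK k l) (tpermK k l)).
Qed.

Lemma polyfun_upd (F : fieldType) (N : nat) (u : point F N) (i j : 'I_N) :
  polyfun (j == i) (fun v => upd u i v j).
Proof.
case: (eqVneq j i) => [->|ji].
  by apply: eq_polyfun (@polyfun_id F) => v; rewrite ffunE eqxx.
by apply: eq_polyfun (polyfunC _ (u j)) => v; rewrite ffunE (negPf ji).
Qed.

Lemma card_pairs_at (N : nat) (i : 'I_N) :
  (\sum_(p : 'I_N * 'I_N | (p.1 < p.2)%N) ((i == p.1) || (i == p.2)) = N.-1)%N.
Proof.
rewrite (eq_bigr (fun p : 'I_N * 'I_N => (i == p.1) + (i == p.2))%N); last first.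
  move=> [a b] /= ab; case: eqP => // ia; case: eqP => // ib.
  by rewrite -ia -ib ltnn in ab.
rewrite big_split /=.
rewrite -(pair_big_dep xpredT (fun a b : 'I_N => (a < b)%N) (fun a b => nat_of_bool (i == a))) /=.
rewrite -(pair_big_dep xpredT (fun a b : 'I_N => (a < b)%N) (fun a b => nat_of_bool (i == b))) /=.
rewrite [X in (_ + X)%N](exchange_big_dep xpredT) //=.
rewrite (bigD1 i) //= [X in (_ + X + _)%N]big1 ?addn0; last first.
  by move=> a ai; rewrite big1 // => b _; rewrite eq_sym (negPf ai).
rewrite [X in (_ + X)%N](bigD1 i) //= [X in (_ + (_ + X))%N]big1 ?addn0; last first.
  by move=> a ai; rewrite big1 // => b _; rewrite eq_sym (negPf ai).
have <- : (\sum_(j | j != i) 1)%N = N.-1.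
  by rewrite sum1_card (eq_card (B := predC1 i)) ?cardC1 ?card_ord // => j; rewrite !inE.
rewrite !eqxx.
rewrite [RHS](bigID (fun j : 'I_N => (i < j)%N)) /=; congr (_ + _)%N; apply: eq_bigl => j;
  by rewrite -val_eqE /=; lia.
Qed.

Section Liouville.
Variables (F : numFieldType) (n N : nat) (hh : F) (zeta : 'I_n -> F).
Hypothesis hh0 : hh != 0.
Local Notation idx := (multi_index n N).
Local Notation fn := {ffun multi_index n N -> F}.
Local Notation word := {ffun 'I_N -> bool}.
Local Notation pt := (point F N).
Local Notation dd := (exch_den hh).
Local Notation cc := (exch_cst hh).
Local Notation yop := (@exch F n N hh).
Local Notation psi := (@psi F n N hh zeta).
Implicit Types (g : fn) (J : idx) (M : word) (u : pt).

(** The factor of a pair i < j in coefficient times Vandermonde product, divided by the denominator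
    [denom] that normalizes [psi] to [flat]. For marks 1, 0 everything cancels; for marks 0, 1 the
    sign comes from u_j - u_i against u_i - u_j. The identity is [coefE]. *)
Definition kap (mi mj : bool) (v w : F) : F :=
  if mi then (if mj then w - v else 1) else (if mj then - dd w v else w - v).

Definition sig M u : F :=
  \prod_(p : 'I_N * 'I_N | (p.1 < p.2)%N) kap (M p.1) (M p.2) (u p.1) (u p.2).

Definition term M u : fn := scl (sig M u) (psi M u).

Definition vand u : F := \prod_(p : 'I_N * 'I_N | (p.1 < p.2)%N) (u p.2 - u p.1).

Definition numer (d : nat) u : fn :=
  \sum_(M : word | #|[set i | M i]| == d) term M u.

Lemma sclA a b g : scl a (scl b g) = scl (a * b) g.
Proof. by apply/ffunP => J; rewrite !ffunE mulrA. Qed.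

(** The coefficients of the Hamiltonians are permuted together with the word, so each term inherits
    the exchange relation of [psi]. The sign is that of the Vandermonde product contained in
    [sig]. *)
Lemma term_swap M u (k l : 'I_N) : l = k.+1 :> nat ->
  scl (dd (u k) (u l)) (term M u) =
  scl (-1) (yop k l (u k) (u l) (term (pull (tperm k l) M) (pull (tperm k l) u))).
Proof.
move=> lk; rewrite /term !exchZ !sclA.
pose X i j := kap (M i) (M j) (u i) (u j).
have -> : sig (pull (tperm k l) M) (pull (tperm k l) u) =
    kap (M l) (M k) (u l) (u k) * \prod_(p : 'I_N * 'I_N | (p.1 < p.2)%N && (p != (k, l))) X p.1 p.2.
  rewrite -(big_pair_swap _ X lk) /=; apply: eq_bigr => p _.
  by rewrite !ffunE.
rewrite /sig (big_pairD1 _ X lk) /= [X k l]/X; set r := \prod_(_ | _ && _) _.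
case Mk: (M k); case Ml: (M l).
- rewrite (pull_tperm_eq (etrans Mk (esym Ml))) mulrC -[in LHS]sclA psi_same ?Mk ?Ml //.
  by congr scl; rewrite /kap; ring.
- rewrite (@psi_step _ _ _ _ _ M _ k l) ?sclA; last by rewrite /descent /= lk Mk Ml eqxx.
  by congr scl; rewrite /kap; ring.
- rewrite (@psi_step _ _ _ _ _ (pull _ _) _ k l); last first.
    by rewrite /descent /= !ffunE tpermL tpermR lk Mk Ml eqxx.
  rewrite !pull_tpermK !ffunE tpermL tpermR exch_unitarity ?adjacent_neq // sclA.
  by congr scl; rewrite /kap; ring.
- rewrite (pull_tperm_eq (etrans Mk (esym Ml))) mulrC -[in LHS]sclA psi_same ?Mk ?Ml //.
  by congr scl; rewrite /kap; ring.
Qed.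

Lemma scl_sum a (I : finType) (P : pred I) (g : I -> fn) :
  scl a (\sum_(i | P i) g i) = \sum_(i | P i) scl a (g i).
Proof.
apply/ffunP => J; rewrite ffunE !sum_ffunE mulr_sumr.
by apply: eq_bigr => i _; rewrite ffunE.
Qed.

Lemma card_pull_tperm M k l :
  #|[set i | pull (tperm k l) M i]| = #|[set i | M i]|.
Proof.
rewrite -(card_preimset [set i | M i] (@perm_inj _ (tperm k l))).
by apply: eq_card => i; rewrite !inE ffunE.
Qed.

Lemma numer_swap d u (k l : 'I_N) : l = k.+1 :> nat ->
  scl (dd (u k) (u l)) (numer d u) =
  scl (-1) (yop k l (u k) (u l) (numer d (pull (tperm k l) u))).
Proof.
move=> lk; rewrite /numer exch_sum !scl_sum.
rewrite [RHS](reindex_inj (inv_inj (@pull_tpermK _ _ k l))) /=.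
apply: eq_big => [M|M _]; first by rewrite card_pull_tperm.
by rewrite term_swap.
Qed.

(** At equal parameters the exchange is the scalar [cc * u k], and [numer_swap] equates this
    multiple of [numer] with its own negative. If the scalar is 0 the relation says nothing, but
    then every term vanishes separately. *)
Lemma numer_adjacent d u (k l : 'I_N) J : l = k.+1 :> nat -> u k = u l ->
  numer d u J = 0.
Proof.
move=> lk ukl; case: (eqVneq (cc * u k) 0) => [z|nz].
  have dz : dd (u k) (u k) = 0 by rewrite -z /exch_den /exch_cst; ring.
  rewrite /numer sum_ffunE big1 // => M _; rewrite /term ffunE.
  rewrite /sig (bigD1 (k, l)) /= ?lk // -ukl.
  case Mk: (M k); case Ml: (M l).
  - by rewrite /kap subrr !mul0r.
  - rewrite (@psi_step _ _ _ _ _ M _ k l); last by rewrite /descent /= lk Mk Ml eqxx.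
    by rewrite -ukl exch_diag z [X in _ * X]ffunE mul0r mulr0.
  - by rewrite /kap dz oppr0 !mul0r.
  - by rewrite /kap subrr !mul0r.
have := numer_swap d u lk; rewrite -ukl exch_diag pull_tperm_eq // => /ffunP/(_ J).
rewrite !ffunE; have -> : dd (u k) (u k) = cc * u k by rewrite /exch_den /exch_cst; ring.
rewrite mulN1r => /eqP; rewrite -subr_eq0 opprK -mulr2n mulrn_eq0 /= mulf_eq0 (negPf nz) /=.
by move/eqP.
Qed.

(** The second of the coinciding coordinates is moved next to the first. Each exchange on the way
    has unequal parameters, where the scalar [dd] in [numer_swap] can be cancelled; an equal
    neighbour is already the adjacent case. *)
Lemma numer_coincident d u (i j : 'I_N) J : i != j -> u i = u j ->
  (forall a b, u a != u b -> dd (u a) (u b) != 0) -> numer d u J = 0.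
Proof.
wlog: i j / (i < j)%N => [H ij uij ok|].
  have [lt|lt|/val_inj e] := ltngtP i j; first exact: (H i j).
    by apply: (H j i); rewrite // eq_sym.
  by rewrite e eqxx in ij.
move=> ij _; have [b] := ubnP (j - i)%N.
elim: b u j ij J => // b IHb u j ij J lb uij ok.
case: (eqVneq (j : nat) i.+1) => [e|ne]; first exact: numer_adjacent e uij.
have lt_k : (j.-1 < N)%N by move: (ltn_ord j); lia.
pose k := Ordinal lt_k; have jk : j = k.+1 :> nat by rewrite /= prednK //; lia.
case: (eqVneq (u k) (u j)) => [e|nkj]; first exact: numer_adjacent jk e.
have ik : i != k by apply: contraNneq ne => ->; rewrite jk.
have ijn : i != j by rewrite -val_eqE /=; lia.
have /ffunP/(_ J) := numer_swap d u jk.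
have -> : numer d (pull (tperm k j) u) = scl 0 0.
  apply/ffunP => K; rewrite [RHS]ffunE mul0r (IHb _ k) //.
  - by rewrite /=; lia.
  - by rewrite /=; lia.
  - by rewrite !ffunE tpermL tpermD // eq_sym.
  - by move=> x y; rewrite !ffunE; apply: ok.
rewrite exchZ !ffunE mul0r mulr0 => /eqP; rewrite mulf_eq0 (negPf (ok _ _ nkj)) /=.
by move/eqP.
Qed.

Definition pairs_at (i : 'I_N) (p : 'I_N * 'I_N) : bool := (i == p.1) || (i == p.2).

(** Bounds the degree of [psi] in u_i: every inversion of [M] through the site i costs one exchange
    that is linear in u_i. *)
Definition inv_at (i : 'I_N) M : nat :=
  \sum_(p : 'I_N * 'I_N | (p.1 < p.2)%N) pairs_at i p && (M p.1 && ~~ M p.2).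

Lemma inv_at_swap i M (k l : 'I_N) : descent M (k, l) ->
  inv_at i M = (((k == i) || (l == i)) + inv_at (tperm k l i) (pull (tperm k l) M))%N.
Proof.
case/and3P => /= /eqP lk Mk Ml.
pose X a b := nat_of_bool (pairs_at i (a, b) && (M a && ~~ M b)).
have -> : inv_at i M = (\sum_(p : 'I_N * 'I_N | (p.1 < p.2)%N) X p.1 p.2)%N.
  by apply: eq_bigr => -[a b].
rewrite (big_pairD1 _ X lk) /= {1}/X Mk Ml !andbT /pairs_at /= ![i == _]eq_sym; congr (_ + _)%N.
have -> : inv_at (tperm k l i) (pull (tperm k l) M) =
    (\sum_(p : 'I_N * 'I_N | (p.1 < p.2)%N) X (tperm k l p.1) (tperm k l p.2))%N.
  apply: eq_bigr => -[a b] _; rewrite /X /pairs_at !ffunE /=.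
  by rewrite !(can2_eq (tpermK k l) (tpermK k l)).
by rewrite (big_pair_swap _ X lk) /= [X l k]/X (negPf Ml) andbF.
Qed.

Lemma polyfun_coord u i k e : (((k == i) : nat) <= e)%N -> polyfun e (fun v => upd u i v k).
Proof. by move=> le; apply: polyfunW le (polyfun_upd u i k). Qed.

Lemma psi_polyfun M u i J : polyfun (inv_at i M) (fun v => psi M (upd u i v) J).
Proof.
have [b] := ubnP (minv M); elim: b M u i J => // b IHb M u i J lb.
have [[k l] dM|noD] := pickP (descent M); last first.
  by apply: eq_polyfun (polyfunC _ (base hh zeta M J)) => v; rewrite psi_base // => p; rewrite noD.
have /and3P[/= /eqP lk Mk Ml] := dM.
have mM := minv_swap lk Mk Ml.
have lt1 : (minv (pull (tperm k l) M) < b)%N by move: lb; rewrite mM ltnS.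
rewrite (inv_at_swap i dM); set e := inv_at _ (pull _ _).
have IH K : polyfun e (fun v => psi (pull (tperm k l) M) (pull (tperm k l) (upd u i v)) K).
  by apply: eq_polyfun (IHb _ (pull (tperm k l) u) (tperm k l i) K lt1) => v; rewrite pull_upd.
have Pk : polyfun ((k == i) || (l == i)) (fun v => upd u i v k).
  by apply: polyfun_coord; case: (k == i).
have Pl : polyfun ((k == i) || (l == i)) (fun v => upd u i v l).
  by apply: polyfun_coord; case: (l == i); rewrite ?orbT.
suff H : polyfun (((k == i) || (l == i)) + e)
    (fun v => yop k l (upd u i v k) (upd u i v l)
      (psi (pull (tperm k l) M) (pull (tperm k l) (upd u i v))) J).
  by apply: eq_polyfun H => v; rewrite -psi_step.
case: (eqVneq (J k) (J l)) => Jkl.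
  apply: eq_polyfun (polyfunM (polyfunB (polyfunZ hh Pl) (polyfunZ hh^-1 Pk)) (IH J)) => v.
  by rewrite [RHS]ffunE Jkl eqxx.
have Pif : polyfun ((k == i) || (l == i))
    (fun v => if (J l < J k)%N then upd u i v l else upd u i v k) by case: (J l < J k)%N.
apply: eq_polyfun (polyfunD (polyfunM (polyfunB Pl Pk) (IH (pull (tperm k l) J)))
  (polyfunM (polyfunZ cc Pif) (IH J))) => v.
by rewrite [RHS]ffunE (negPf Jkl).
Qed.

Lemma sig_polyfun M u i :
  polyfun (\sum_(p : 'I_N * 'I_N | (p.1 < p.2)%N) pairs_at i p && ~~ (M p.1 && ~~ M p.2))
    (fun v => sig M (upd u i v)).
Proof.
apply: polyfun_prod => -[a b] /= _.
have Pa : polyfun (pairs_at i (a, b)) (fun v => upd u i v a).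
  by apply: polyfun_coord; rewrite /pairs_at /= eq_sym; case: (i == a).
have Pb : polyfun (pairs_at i (a, b)) (fun v => upd u i v b).
  by apply: polyfun_coord; rewrite /pairs_at /= [b == i]eq_sym; case: (i == b); rewrite ?orbT.
rewrite /kap; case: (M a); case: (M b); rewrite /= ?andbT ?andbF.
- exact: polyfunB.
- exact: polyfunC.
- apply: eq_polyfun (polyfunB (polyfunZ hh^-1 Pb) (polyfunZ hh Pa)) => v.
  by rewrite /exch_den; ring.
- exact: polyfunB.
Qed.

Lemma numer_polyfun d u i J : polyfun N.-1 (fun v => numer d (upd u i v) J).
Proof.
suff H : polyfun N.-1 (fun v => \sum_(M : word | #|[set i | M i]| == d) term M (upd u i v) J).
  by apply: eq_polyfun H => v; rewrite /numer sum_ffunE.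
apply: polyfun_sum => M _.
suff H : polyfun N.-1 (fun v => sig M (upd u i v) * psi M (upd u i v) J).
  by apply: eq_polyfun H => v; rewrite ffunE.
apply: polyfunW (polyfunM (sig_polyfun M u i) (psi_polyfun M u i J)).
(* A pair through i raises the degree bound of [psi] if it is an inversion of [M], and that of [sig]
   otherwise, never both. There are N - 1 such pairs. *)
rewrite -(card_pairs_at i) -big_split /=; apply: leq_sum => p _; rewrite -/(pairs_at i p).
by case: (pairs_at i p); case: (M p.1 && ~~ M p.2).
Qed.

Lemma vand_polyfun u i : polyfun N.-1 (fun v => vand (upd u i v)).
Proof.
rewrite -(card_pairs_at i); apply: polyfun_prod => -[a b] /= _; rewrite ![i == _]eq_sym.
by apply: polyfunB; apply: polyfun_coord; case: eqP => //=; rewrite ?orbT.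
Qed.

Lemma vand_coincident u (i j : 'I_N) : i != j -> u i = u j -> vand u = 0.
Proof.
wlog: i j / (i < j)%N => [H ij uij|].
  have [lt|lt|/val_inj e] := ltngtP i j; first exact: (H i j).
    by apply: (H j i); rewrite // eq_sym.
  by rewrite e eqxx in ij.
by move=> ij _ uij; rewrite /vand (bigD1 (i, j)) //= uij subrr mul0r.
Qed.

Lemma vand_swap u (k l : 'I_N) : l = k.+1 :> nat -> vand (pull (tperm k l) u) = - vand u.
Proof.
move=> lk; pose X a b := u b - u a.
rewrite /vand (big_pairD1 _ X lk) /=.
rewrite (eq_bigr (fun p => X (tperm k l p.1) (tperm k l p.2))); last by move=> p _; rewrite !ffunE.
by rewrite (big_pair_swap _ X lk) /= -mulNr [X l k]/X opprB.
Qed.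

(* The pairs at which neither the R-matrices nor the coefficients of the
   Hamiltonians have a pole. *)
Definition ok2 (x y : F) : bool := [&& x != y, dd x y != 0 & dd y x != 0].

Lemma ok2_sym x y : ok2 x y = ok2 y x.
Proof. by rewrite /ok2 eq_sym; congr (_ && _); rewrite andbC. Qed.

Definition generic u : Prop := forall i j, i != j -> ok2 (u i) (u j).

Lemma vand_neq0 u : generic u -> vand u != 0.
Proof.
move=> gu; apply/prodf_neq0 => -[a b] /= ab; rewrite subr_eq0 eq_sym.
by have /and3P[] : ok2 (u a) (u b) by apply: gu; rewrite neq_ltn ab.
Qed.

(** As a function of the i-th coordinate the difference has degree below N. It has N distinct roots:
    v, and the other N - 1 coordinates, where [numer] and [vand] both vanish. *)
Lemma numer_upd d u i v J : generic u -> generic (upd u i v) ->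
  numer d u J * vand (upd u i v) = numer d (upd u i v) J * vand u.
Proof.
move=> gu gv; apply/eqP; rewrite -subr_eq0; apply/eqP.
pose f z := numer d (upd u i z) J * vand (upd u i v) - numer d (upd u i v) J * vand (upd u i z).
have -> : numer d u J * vand (upd u i v) - numer d (upd u i v) J * vand u = f (u i).
  by rewrite /f upd_same.
have Pf : polyfun N.-1 f.
  apply: eq_polyfun (polyfunB (polyfunZ (vand (upd u i v)) (numer_polyfun d u i J))
    (polyfunZ (numer d (upd u i v) J) (vand_polyfun u i))) => z.
  by rewrite /f [X in X - _]mulrC.
apply: (polyfun_eq0 (s := codom (upd u i v)) Pf).
- apply/injectiveP => a b eab; apply/eqP/negPn/negP => ab.
  by have /and3P[] := gv a b ab; rewrite eab eqxx.
- by rewrite size_codom card_ord; have := ltn_ord i; lia.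
- move=> z /codomP[j ->]; rewrite [X in f X]ffunE; case: eqP => [_|/eqP ji].
    by rewrite /f mulrC [X in X - _]mulrC mulrC subrr.
  have uji : upd u i (u j) i = upd u i (u j) j by rewrite !ffunE eqxx (negPf ji).
  have ij : i != j by rewrite eq_sym.
  rewrite /f (vand_coincident ij uji) (numer_coincident _ _ ij uji) ?mul0r ?mulr0 ?subrr //.
  (* Replacing u_i by u_j creates no new value, so the genericity of [u] covers the unequal pairs of
     this point. *)
  move=> a b; pose e x := if x == i then j else x.
  have ue x : upd u i (u j) x = u (e x) by rewrite ffunE /e; case: ifP.
  rewrite !ue => ne; have : e a != e b by apply: contraNneq ne => ->.
  by move/gu => /and3P[].
Qed.

Lemma fresh_elt (s : seq F) : exists y, y \notin s.
Proof.
pose t := [seq (i%:R : F) | i <- iota 0 (size s).+1].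
have ut : uniq t.
  by rewrite map_inj_uniq ?iota_uniq // => a b /eqP; rewrite eqr_nat => /eqP.
have [/allP H|/allPn[y _ ys]] := boolP (all (mem s) t); last by exists y.
by have := uniq_leq_size ut H; rewrite size_map size_iota ltnn.
Qed.

(** Each x forbids only the values x, hh^2 x and hh^-2 x. *)
Lemma fresh_ok2 (s : seq F) : exists y, all (ok2 y) s.
Proof.
have [y] := fresh_elt (s ++ [seq hh * hh * x | x <- s] ++ [seq hh^-1 * hh^-1 * x | x <- s]).
rewrite !mem_cat !negb_or => /and3P[y1 y2 y3]; exists y; apply/allP => x xs.
apply/and3P; split.
- by apply: contraNneq y1 => ->.
- apply: contraNneq y2; rewrite /exch_den => /eqP; rewrite subr_eq0 => /eqP e.
  apply/mapP; exists x => //; apply: (mulfI (invr_neq0 hh0)).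
  by rewrite -e !mulrA mulVf // mul1r.
- apply: contraNneq y3; rewrite /exch_den => /eqP; rewrite subr_eq0 => /eqP e.
  by apply/mapP; exists x => //; apply: (mulfI hh0); rewrite e !mulrA mulfV // mul1r.
Qed.

Lemma fresh_seq m (s : seq F) :
  exists2 t : seq F, size t = m & pairwise ok2 t && allrel ok2 t s.
Proof.
elim: m s => [|m IHm] s; first by exists [::].
have [y ys] := fresh_ok2 s; have [t st /andP[pt rt]] := IHm (y :: s).
exists (y :: t); first by rewrite /= st.
rewrite /= allrel_consl ys pt /=; apply/andP; split; last first.
  by apply/allrelP => a b at' bs; move/allrelP: rt => /(_ a b at'); apply; rewrite inE bs orbT.
rewrite andbT; apply/allP => a at'; rewrite ok2_sym.
by move/allrelP: rt => /(_ a y at'); apply; rewrite inE eqxx.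
Qed.

Lemma generic_ex (s : seq F) :
  exists w, generic w /\ forall i x, x \in s -> ok2 (w i) x.
Proof.
have [t st /andP[pt rt]] := fresh_seq N s.
exists [ffun i : 'I_N => nth 0 t i]; split=> [i j|i x xs]; rewrite !ffunE; last first.
  by move/allrelP: rt; apply=> //; rewrite mem_nth ?st.
rewrite -val_eqE /= neq_ltn => /orP[] lt; last rewrite ok2_sym;
  by move/(pairwiseP 0): pt; apply; rewrite ?inE ?st.
Qed.

(** The coordinates of [u] are replaced by those of [w] one at a time; mutual genericity keeps every
    intermediate point generic. *)
Lemma numer_mix d u w J : generic u -> generic w ->
  (forall i j, ok2 (w i) (u j)) -> numer d u J * vand w = numer d w J * vand u.
Proof.
move=> gu gw wu; pose mix (k : nat) : pt := [ffun i : 'I_N => if (i < k)%N then w i else u i].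
have gm k : generic (mix k).
  move=> i j ij; rewrite !ffunE; case: ifP => _; case: ifP => _.
  - exact: gw.
  - exact: wu.
  - by rewrite ok2_sym wu.
  - exact: gu.
suff H k : (k <= N)%N -> numer d u J * vand (mix k) = numer d (mix k) J * vand u.
  have <- : mix N = w by apply/ffunP => i; rewrite ffunE ltn_ord.
  exact: H.
elim: k => [|k IHk] kN.
  by have -> : mix 0%N = u by apply/ffunP => i; rewrite ffunE ltn0.
have e : mix k.+1 = upd (mix k) (Ordinal kN) (w (Ordinal kN)).
  apply/ffunP => i; rewrite !ffunE -val_eqE /= ltnS leq_eqVlt.
  by case: eqP => [ik|//]; congr (w _); apply: val_inj.
have := numer_upd d J (gm k); move/(_ (Ordinal kN) (w (Ordinal kN))); rewrite -e => /(_ (gm _)) H.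
apply: (mulIf (vand_neq0 (gm k))).
by rewrite mulrAC IHk 1?ltnW // mulrAC H mulrAC.
Qed.

Lemma numer_const d : exists Gam : fn, forall u, generic u ->
  numer d u = scl (vand u) Gam.
Proof.
have [u0 [g0 _]] := generic_ex [::].
exists (scl (vand u0)^-1 (numer d u0)) => u gu; apply/ffunP => J; rewrite !ffunE.
(* [u] and [u0] need not be mutually generic, so both are compared with a third point. *)
have [w [gw ww]] := generic_ex (codom u ++ codom u0).
have h1 : numer d u J * vand w = numer d w J * vand u.
  by apply: numer_mix => // i j; apply: ww; rewrite mem_cat codom_f.
have h0 : numer d u0 J * vand w = numer d w J * vand u0.
  by apply: numer_mix => // i j; apply: ww; rewrite mem_cat codom_f orbT.
have e : numer d w J = numer d u0 J * vand w / vand u0 by rewrite h0 mulfK // vand_neq0.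
by apply: (mulIf (vand_neq0 gw)); rewrite h1 e; ring.
Qed.

End Liouville.

(** * Sorting *)

Section Sorting.
Variables n N : nat.
Implicit Types J : multi_index n N.

Definition inversions J : nat :=
  \sum_(p : 'I_N * 'I_N | (p.1 < p.2)%N) (J p.2 < J p.1)%N.

Lemma inversions_swap J (k l : 'I_N) : l = k.+1 :> nat ->
  ((J k < J l)%N + inversions J = (J l < J k)%N + inversions (pull (tperm k l) J))%N.
Proof.
move=> lk; pose X a b := nat_of_bool (J b < J a)%N.
rewrite /inversions (big_pairD1 _ X lk) /=.
rewrite [in RHS](eq_bigr (fun p => X (tperm k l p.1) (tperm k l p.2))); last first.
  by move=> p _; rewrite !ffunE.
by rewrite (big_pair_swap _ X lk) /= [X k l]/X [X l k]/X; lia.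
Qed.

Lemma nondecreasing_inversions J : nondecreasing_index J -> inversions J = 0%N.
Proof.
move=> /forallP sJ; rewrite /inversions big1 // => -[a b] /= ab.
have /forallP/(_ b)/implyP := sJ a; move=> /(_ (ltnW ab)).
by rewrite ltnNge => ->.
Qed.

Lemma adjacent_descent J : ~~ nondecreasing_index J ->
  exists k l : 'I_N, l = k.+1 :> nat /\ (J l < J k)%N.
Proof.
have [/existsP[k /existsP[l /andP[/eqP lk lt]]] _|noD] :=
  boolP [exists k : 'I_N, exists l : 'I_N, (l == k.+1 :> nat) && (J l < J k)%N].
  by exists k, l.
case/negP; apply/forallP => k; apply/forallP => l; apply/implyP => kl.
have [b] := ubnP (l - k)%N; elim: b l kl => // b IHb l kl lb.
have [e|kl'] := eqVneq (k : nat) l; first by rewrite (val_inj e).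
have lt : (l.-1 < N)%N by have := ltn_ord l; lia.
have h : (J k <= J (Ordinal lt))%N by apply: IHb => /=; lia.
apply: leq_trans h _; rewrite leqNgt; apply: contra noD => ltJ.
apply/existsP; exists (Ordinal lt); apply/existsP; exists l; rewrite ltJ andbT /=.
by apply/eqP; lia.
Qed.

Lemma sortable_inversions J : sortable_in (inversions J) J.
Proof.
have [b] := ubnP (inversions J); elim: b J => // b IHb J lb.
have [sJ|/adjacent_descent[k [l [lk lt]]]] := boolP (nondecreasing_index J).
  by rewrite nondecreasing_inversions.
have := inversions_swap J lk; rewrite lt ltnNge (ltnW lt) /= add0n => e.
rewrite e /=; apply/existsP; exists k; apply/existsP; exists l; rewrite lk eqxx.
by apply: IHb; move: lb; rewrite e.
Qed.

Lemma sortable_inversions_le m J : sortable_in m J -> (inversions J <= m)%N.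
Proof.
elim: m J => [|m IHm] J /=; first by move=> /nondecreasing_inversions ->.
move=> /existsP[k /existsP[l /andP[/eqP lk /IHm le]]].
rewrite -[swap_sites J k l]/(pull (tperm k l) J) in le.
by have := inversions_swap J lk; case: ltngtP => _ /=; move: le; lia.
Qed.

(** An adjacent swap lowers the number of inversions by at most one, and by exactly one at a
    descent. *)
Lemma ellE J : ell J = inversions J.
Proof.
rewrite /ell; case: ex_minnP => m sm min; apply/eqP.
by rewrite eqn_leq sortable_inversions_le // min // sortable_inversions.
Qed.

Lemma of_weight_pull s (c : 'I_N -> 'I_N) J : injective c ->
  of_weight s J -> of_weight s (pull c J).
Proof.
move=> cI /forallP w; apply/forallP => x; rewrite -(eqP (w x)).
rewrite -(card_preimset [set k | J k == x] cI); apply/eqP/eq_card => k.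
by rewrite !inE ffunE.
Qed.

Lemma nondecreasing_unique s J J' : of_weight s J -> of_weight s J' ->
  nondecreasing_index J -> nondecreasing_index J' -> J = J'.
Proof.
move=> w w' d d'; pose r (x y : 'I_n) := (x <= y)%N.
have sorted_codom (K : multi_index n N) : nondecreasing_index K -> sorted r (codom K).
  move=> /forallP dK; rewrite /codom.
  apply: (@homo_sorted _ _ K (fun x y : 'I_N => (x <= y)%N)).
    by move=> x y; have /forallP/(_ y)/implyP := dK x.
  have := iota_sorted 0 N; rewrite -val_enum_ord sorted_map.
  by apply: sub_sorted.
have count_codom (K : multi_index n N) x : of_weight s K -> count_mem x (codom K) = s x.
  move=> /forallP/(_ x)/eqP <-; rewrite count_map -size_filter cardE.
  by congr size; rewrite enumT; apply: eq_filter => k; rewrite !inE.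
have e : codom J = codom J'.
  apply: (sorted_eq (leT := r)).
  - by move=> x y z; apply: leq_trans.
  - by move=> x y /anti_leq; apply: val_inj.
  - exact: sorted_codom.
  - exact: sorted_codom.
  - by apply/allP => x _ /=; rewrite !count_codom.
apply/ffunP => k; move/eq_in_map: e; apply; exact: mem_enum.
Qed.

(** Sorting J through adjacent descents collects one factor hh per inversion and ends at the only
    nondecreasing multi-index of weight s; E is the value of [g] there. *)
Lemma exchange_weight (F : fieldType) (hh : F) (g : {ffun multi_index n N -> F})
    (s : 'I_n -> nat) :
  (forall J (k l : 'I_N), l = k.+1 :> nat -> (J k < J l)%N ->
     g (pull (tperm k l) J) = hh * g J) ->
  exists E, forall J, of_weight s J -> g J = hh ^+ inversions J * E.
Proof.
move=> ex.
have sort_to J : of_weight s J -> exists J0, [/\ nondecreasing_index J0, of_weight s J0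
    & g J = hh ^+ inversions J * g J0].
  have [b] := ubnP (inversions J); elim: b J => // b IHb J lb wJ.
  have [sJ|/adjacent_descent[k [l [lk lt]]]] := boolP (nondecreasing_index J).
    by exists J; rewrite nondecreasing_inversions // expr0 mul1r.
  have := inversions_swap J lk; rewrite lt ltnNge (ltnW lt) /= add0n => e.
  have [|J0 [d0 w0 g0]] := IHb (pull (tperm k l) J) _ (of_weight_pull (@perm_inj _ _) wJ).
    by move: lb; rewrite e.
  exists J0; split=> //; rewrite -{1}(pull_tpermK k l J) ex //.
    by rewrite g0 e exprS mulrA.
  by rewrite !ffunE tpermL tpermR.
have [J0 /andP[d0 w0]|none] := pickP (fun J => nondecreasing_index J && of_weight s J).
  exists (g J0) => J /sort_to[J1 [d1 w1 ->]].
  by rewrite (nondecreasing_unique w1 w0 d1 d0).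
(* No multi-index has weight s, for instance when the s_a do not add up to N; the constant is then
   arbitrary. *)
by exists 0 => J /sort_to[J1 [d1 w1 _]]; have := none J1; rewrite d1 w1.
Qed.

End Sorting.

(** * Transposes of the R-matrices and of the twist with respect to the pairing *)

Section Adjoints.
Variables (F : fieldType) (n N : nat) (hh : F) (zeta : 'I_n -> F).
Local Notation V := (tensor F n N).
Local Notation idx := (multi_index n N).
Local Notation fn := {ffun multi_index n N -> F}.
Implicit Types (v : V) (g : fn) (J : idx).

Lemma munit_munit b c b' c' (i j : 'I_N) v J : i != j ->
  munit b c i (munit b' c' j v) J =
  if (J i == b) && (J j == b') then v (subst_site (subst_site J i c) j c') else 0.
Proof. by move=> ij; rewrite !ffunE [j == i]eq_sym (negPf ij); case: eqP. Qed.

Lemma sum_pair_pick (P : rel 'I_n) (f : 'I_n -> 'I_n -> F) (x y : 'I_n) :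
  \sum_(b < n) \sum_(c < n | P b c) (if (x == b) && (y == c) then f b c else 0) =
  if P x y then f x y else 0.
Proof.
rewrite (bigD1 x) //= [X in _ + X]big1 ?addr0; last first.
  by move=> b bx; rewrite big1 // => c _; rewrite eq_sym (negPf bx).
under eq_bigr do rewrite eqxx /=.
rewrite big_mkcond (bigD1 y) //= [X in _ + X]big1 ?addr0; last first.
  by move=> c cy; rewrite [y == c]eq_sym (negPf cy); case: ifP.
by rewrite eqxx.
Qed.

Lemma subst_site_id J (i j : 'I_N) : subst_site (subst_site J i (J i)) j (J j) = J.
Proof. by apply/ffunP => k; rewrite !ffunE; case: eqP => [->|_] //; case: eqP => [->|]. Qed.

Lemma subst_site_swap J (i j : 'I_N) :
  subst_site (subst_site J i (J j)) j (J i) = pull (tperm i j) J.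
Proof.
apply/ffunP => k; rewrite !ffunE; case: (tpermP i j k) => [->|->|/eqP/negPf -> /eqP/negPf ->] //.
  by rewrite eqxx; case: eqP => // ->.
by rewrite eqxx.
Qed.

Lemma RmatE (i j : 'I_N) x v J : i != j ->
  Rmat hh i j x v J =
  if J i == J j then v J
  else (x - x^-1) / (hh * x - hh^-1 * x^-1) * v J
       + (hh - hh^-1) / (hh * x - hh^-1 * x^-1) *
         (if (J i < J j)%N then x else x^-1) * v (pull (tperm i j) J).
Proof.
move=> ij; rewrite /Rmat.
set al := (x - x^-1) / _; set be := (hh - hh^-1) / _.
have scE (a : F) (w : V) : (a *: w) J = a * w J by rewrite ffunE.
rewrite ffunE [X in X + _]ffunE !scE !sum_ffunE.
have -> : \sum_(b < n) munit b b i (munit b b j v) J = if J i == J j then v J else 0.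
  rewrite (bigD1 (J i)) //= [X in _ + X]big1 ?addr0; last first.
    by move=> b bi; rewrite munit_munit // eq_sym (negPf bi).
  rewrite munit_munit // eqxx [J j == _]eq_sym /=; case: eqP => // e.
  by rewrite {2}e subst_site_id.
have -> : \sum_(b < n) (\sum_(c < n | b != c) munit b b i (munit c c j v)) J =
    if J i == J j then 0 else v J.
  have := sum_pair_pick (fun b c => b != c) (fun b c => v (subst_site (subst_site J i b) j c))
    (J i) (J j).
  rewrite subst_site_id if_neg => <-.
  apply: eq_bigr => b _; rewrite sum_ffunE; apply: eq_bigr => c _.
  by rewrite munit_munit.
have -> : \sum_(b < n) (\sum_(c < n | (b < c)%N)
    (x *: munit b c i (munit c b j v) + x^-1 *: munit c b i (munit b c j v))) J =
    if J i == J j then 0 else (if (J i < J j)%N then x else x^-1) * v (pull (tperm i j) J).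
  rewrite (eq_bigr (fun b : 'I_n => (\sum_(c < n | (b < c)%N)
      (if (J i == b) && (J j == c) then x * v (subst_site (subst_site J i c) j b) else 0)) +
      \sum_(c < n | (b < c)%N)
      (if (J j == b) && (J i == c) then x^-1 * v (subst_site (subst_site J i b) j c) else 0))); last first.
    move=> b _; rewrite sum_ffunE -big_split; apply: eq_bigr => c _.
    rewrite ffunE !scE !munit_munit // [(J j == b) && _]andbC.
    by case: ifP => _; case: ifP => _; rewrite ?mulr0.
  rewrite big_split /=.
  rewrite (sum_pair_pick (fun b c : 'I_n => (b < c)%N) (fun b c => x * v (subst_site (subst_site J i c) j b))).
  rewrite (sum_pair_pick (fun b c : 'I_n => (b < c)%N) (fun b c => x^-1 * v (subst_site (subst_site J i b) j c))).
  rewrite !subst_site_swap -val_eqE /=.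
  by case: ltngtP => _; rewrite ?addr0 ?add0r.
by case: ifP => _; rewrite ?mulr0 ?addr0 ?add0r ?mulrA.
Qed.

(** Transposition interchanges e_ab and e_ba, hence the comparison of letters is opposite to that in
    [RmatE]. *)
Definition RT (i j : 'I_N) x g : fn :=
  [ffun J : idx => if J i == J j then g J
    else (x - x^-1) / (hh * x - hh^-1 * x^-1) * g J
       + (hh - hh^-1) / (hh * x - hh^-1 * x^-1) *
         (if (J j < J i)%N then x else x^-1) * g (pull (tperm i j) J)].

Lemma pairing_Rmat (i j : 'I_N) x g v : i != j ->
  pairing g (Rmat hh i j x v) = pairing (RT i j x g) v.
Proof.
move=> ij; rewrite /pairing.
set al := (x - x^-1) / (hh * x - hh^-1 * x^-1).
set be := (hh - hh^-1) / (hh * x - hh^-1 * x^-1).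
pose f J := if J i == J j then g J else al * g J.
pose h J := if J i == J j then 0 else be * (if (J i < J j)%N then x else x^-1) * g J.
rewrite (eq_bigr (fun J => f J * v J + h J * v (pull (tperm i j) J))); last first.
  by move=> J _; rewrite RmatE // /f /h; case: ifP => _; rewrite -/al -/be; ring.
rewrite [RHS](eq_bigr (fun J => f J * v J + h (pull (tperm i j) J) * v J)); last first.
  move=> J _; rewrite ffunE /f /h !ffunE tpermL tpermR [J j == _]eq_sym.
  by case: (J i == J j); rewrite ?mul0r ?addr0 // mulrDl.
rewrite !big_split /=; congr (_ + _).
rewrite [RHS](reindex_inj (inv_inj (@pull_tpermK _ _ i j))) /=.
by apply: eq_bigr => J _; rewrite pull_tpermK.
Qed.

Definition ZT (i : 'I_N) g : fn := [ffun J : idx => zeta (J i) * g J].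

Lemma pairing_Zmat (i : 'I_N) g v :
  pairing g (Zmat zeta i v) = pairing (ZT i g) v.
Proof.
apply: eq_bigr => J _; rewrite /Zmat sum_ffunE (bigD1 (J i)) //= big1; last first.
  by move=> b bi; rewrite !ffunE eq_sym (negPf bi) scaler0.
rewrite addr0 !ffunE eqxx.
have -> : subst_site J i (J i) = J by apply/ffunP => k; rewrite ffunE; case: eqP => [->|].
by rewrite [zeta _ *: _]/(zeta (J i) * v J) mulrCA mulrA.
Qed.

Lemma pairing_op_prod (js : seq 'I_N) (A : 'I_N -> V -> V) (AT : 'I_N -> fn -> fn) g v :
  (forall j, j \in js -> forall g v, pairing g (A j v) = pairing (AT j g) v) ->
  pairing g (op_prod js A v) = pairing (foldl (fun g j => AT j g) g js) v.
Proof.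
elim: js g => [|j js IHjs] g adj //=; rewrite adj ?mem_head //.
by apply: IHjs => j' j'js; apply: adj; rewrite inE j'js orbT.
Qed.

End Adjoints.

(** * Cyclic rotations of the sites *)

Section Rotations.
Variable N : nat.
Implicit Types (i m : 'I_N) (p : nat).

(* The order-preserving relabelling that puts the site i at the place p. *)
Definition rotn p (i m : nat) : nat :=
  if m == p then i else if (p < m <= i)%N then m.-1 else
  if (i <= m < p)%N then m.+1 else m.

Definition rot_site p i m : 'I_N := insubd m (rotn p i m).

Lemma val_rot_site p i m : (p < N)%N -> rot_site p i m = rotn p i m :> nat.
Proof.
move=> pN; rewrite val_insubd /rotn; have := ltn_ord i; have := ltn_ord m.
by do ![case: ifP]; lia.
Qed.

Lemma rot_site_inj p i : (p < N)%N -> injective (rot_site p i).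
Proof.
move=> pN m m' /(congr1 val) /=; rewrite !val_rot_site // /rotn => e; apply: val_inj => /=.
by move: e; do ![case: ifP]; lia.
Qed.

Lemma rot_site_id i m : rot_site i i m = m.
Proof. by apply: val_inj; rewrite /= val_rot_site // /rotn; do ![case: ifP]; lia. Qed.

Lemma rot_site_tperm (i k l : 'I_N) : l = k.+1 :> nat ->
  rot_site l i \o tperm k l =1 rot_site k i.
Proof.
move=> lk m; apply: val_inj; rewrite /= !val_rot_site // tperm_if /rotn.
rewrite -![m == _]val_eqE /=.
by do ![case: ifP => /=]; lia.
Qed.

Lemma rot_site_at i p (k : 'I_N) : k = p :> nat -> rot_site p i k = i.
Proof.
by move=> kp; apply: val_inj; rewrite /= val_rot_site /rotn ?kp ?eqxx // -kp.
Qed.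

Lemma enum_filter_rcons (P Q : pred 'I_N) k : P k ->
  (forall j, P j -> (j <= k)%N) -> (forall j, Q j = P j && (j != k)) ->
  [seq j <- enum 'I_N | P j] = rcons [seq j <- enum 'I_N | Q j] k.
Proof.
move=> Pk Pmax QE; pose r (a b : 'I_N) := (a < b)%N.
have tr : transitive r by move=> a b c; apply: ltn_trans.
have sorted_enum (P' : pred 'I_N) : sorted r [seq j <- enum 'I_N | P' j].
  by apply: sorted_filter => //; have := iota_ltn_sorted 0 N; rewrite -val_enum_ord sorted_map.
apply: (irr_sorted_eq tr); [by move=> a; rewrite /r ltnn|exact: sorted_enum| |].
  rewrite sorted_pairwise // pairwise_rcons -sorted_pairwise // sorted_enum andbT.
  apply/allP => j; rewrite mem_filter QE => /andP[/andP[Pj jk] _].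
  by rewrite /r ltn_neqAle Pmax // andbT.
move=> j; rewrite mem_rcons inE (mem_filter P) (mem_filter Q) !mem_enum !andbT QE.
by case: eqP => [->|_]; rewrite ?andbT ?Pk.
Qed.

End Rotations.

(** * Moving the first site to the last place *)

Section PairRotation.
Variables (N : nat) (S : Type) (idx : S) (op : Monoid.com_law idx).
Variables (o t : 'I_N).
Hypotheses (o0 : o = 0%N :> nat) (tN : t = N.-1 :> nat).
Let N0 : (0 < N)%N. Proof. exact: leq_ltn_trans (ltn_ord o). Qed.
Let rho := rot_site N.-1 o.

Lemma rhoE m : rho m = (if m == t then 0%N else m.+1) :> nat.
Proof.
rewrite val_rot_site ?prednK // /rotn o0 -val_eqE /= tN.
by have := ltn_ord m; do ![case: ifP]; lia.
Qed.

Lemma rho_inj : injective rho.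
Proof. by apply: rot_site_inj; rewrite prednK. Qed.

Lemma rho_last : rho t = o.
Proof. by apply: val_inj; rewrite /= rhoE eqxx o0. Qed.

(** Only the pairs through [o] change their order. They become the pairs ending at the last place
    [t], with [o] still the first argument of [X]. *)
Lemma big_pair_rot (X : 'I_N -> 'I_N -> S) :
  \big[op/idx]_(p : 'I_N * 'I_N | (p.1 < p.2)%N) X p.1 p.2 =
  \big[op/idx]_(p : 'I_N * 'I_N | (p.1 < p.2)%N)
    (if p.2 == t then X o (rho p.1) else X (rho p.1) (rho p.2)).
Proof.
have lt (x : 'I_N) : (x.-1 < N)%N by have := ltn_ord x; lia.
pose rho' x : 'I_N := if x == o then t else Ordinal (lt x).
have rho'E x : rho' x = (if x == 0%N :> nat then N.-1 else x.-1) :> nat.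
  by rewrite /rho' -val_eqE /= o0; case: eqP => // _; rewrite tN.
have K : cancel rho rho'.
  move=> m; apply: val_inj; rewrite /= rho'E rhoE -val_eqE /= tN.
  by have := ltn_ord m; do ![case: eqP => /=]; lia.
have K' : cancel rho' rho.
  move=> m; apply: val_inj; rewrite /= rhoE -val_eqE /= rho'E tN.
  by have := ltn_ord m; do ![case: eqP => /=]; lia.
pose h (p : 'I_N * 'I_N) := if p.2 == t then (o, rho p.1) else (rho p.1, rho p.2).
pose h' (p : 'I_N * 'I_N) := if p.1 == o then (rho' p.2, t) else (rho' p.1, rho' p.2).
have rho'_t x : (rho' x == t) = (x == o) by rewrite -(can_eq K) K' rho_last.
rewrite (reindex_onto h h') /=; last first.
  move=> [a b] /= ab; rewrite /h /h' /=; case: (eqVneq a o) => [->|ao] /=.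
    by rewrite eqxx K'.
  rewrite rho'_t; case: (eqVneq b o) => [bo|_]; last by rewrite !K'.
  by move: ab; rewrite bo o0.
apply: eq_big => [[a b]|[a b] _]; last by rewrite /h /=; case: ifP.
have rho_o x : (rho x == o) = (x == t) by rewrite -rho_last (inj_eq rho_inj).
rewrite /h /h' /=; case: (eqVneq b t) => [->|bt] /=.
  rewrite eqxx K eqxx andbT rhoE o0 -val_eqE /= tN.
  by have := ltn_ord a; case: eqP; lia.
rewrite rho_o; case: (eqVneq a t) => [->|at'].
  rewrite K xpair_eqE [t == b]eq_sym (negPf bt) andbF.
  by have := ltn_ord b; rewrite tN; lia.
by rewrite !K eqxx andbT !rhoE (negPf bt) (negPf at') ltnS.
Qed.

End PairRotation.

Lemma prod_pairs (F : comNzRingType) (N : nat) (Y : 'I_N -> 'I_N -> F) :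
  (forall i, Y i i = 1) ->
  \prod_i \prod_j Y i j = \prod_(p : 'I_N * 'I_N | (p.1 < p.2)%N) (Y p.1 p.2 * Y p.2 p.1).
Proof.
move=> Y1; rewrite pair_big /= big_split /=.
rewrite (bigID (fun p : 'I_N * 'I_N => (p.1 < p.2)%N)) /=; congr (_ * _).
rewrite (bigID (fun p : 'I_N * 'I_N => (p.2 < p.1)%N)) /=.
rewrite [X in _ * X]big1 ?mulr1; last first.
  move=> [a b] /= /andP[ab ba]; have -> : a = b by apply: val_inj => /=; lia.
  exact: Y1.
rewrite (reindex_inj (h := fun p : 'I_N * 'I_N => (p.2, p.1))) /=; last by move=> [a b] [c d] [-> ->].
by apply: eq_bigl => -[a b] /=; lia.
Qed.

(** * Transport through the qKZ operators *)

Section Transport.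
Variables (F : numFieldType) (n N : nat) (hh : F) (zeta : 'I_n -> F).
Hypothesis hh0 : hh != 0.
Local Notation idx := (multi_index n N).
Local Notation fn := {ffun multi_index n N -> F}.
Local Notation word := {ffun 'I_N -> bool}.
Local Notation pt := (point F N).
Local Notation dd := (exch_den hh).
Local Notation cc := (exch_cst hh).
Local Notation yop := (@exch F n N hh).
Local Notation base := (@base F n N hh zeta).
Local Notation psi := (@psi F n N hh zeta).
Local Notation generic := (@generic F N hh).
Local Notation RT := (@RT F n N hh).
Implicit Types (g : fn) (J K : idx) (M : word) (u : pt).

(** Every exchange in [psi] is [dd] times a braid-form R-matrix. The marked site i and the unmarked
    site j of an inversion meet exactly once, so this product removes all these factors. *)
Definition denom M u : F :=
  \prod_(p : 'I_N * 'I_N | (p.1 < p.2)%N)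
    (if M p.1 && ~~ M p.2 then dd (u p.1) (u p.2) else 1).

Definition flat M u : fn := scl (denom M u)^-1 (psi M u).

Lemma flat_swap M u (k l : 'I_N) : l = k.+1 :> nat ->
  dd (u k) (u l) != 0 -> dd (u l) (u k) != 0 ->
  yop k l (u k) (u l) (flat (pull (tperm k l) M) (pull (tperm k l) u)) =
  scl (dd (u k) (u l)) (flat M u).
Proof.
move=> lk d1 d2; rewrite /flat exchZ sclA.
pose X i j := if M i && ~~ M j then dd (u i) (u j) else 1.
have -> : denom (pull (tperm k l) M) (pull (tperm k l) u) =
    X l k * \prod_(p : 'I_N * 'I_N | (p.1 < p.2)%N && (p != (k, l))) X p.1 p.2.
  rewrite -(big_pair_swap _ X lk) /=; apply: eq_bigr => p _.
  by rewrite !ffunE.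
rewrite /denom (big_pairD1 _ X lk) /= [X k l]/X [X l k]/X; set r := \prod_(_ | _ && _) _.
case Mk: (M k); case Ml: (M l) => /=.
- rewrite (pull_tperm_eq (etrans Mk (esym Ml))) -psi_same ?Mk ?Ml //.
  by rewrite sclA mulrC.
- rewrite -(@psi_step _ _ _ _ _ M _ k l) ?mul1r; last by rewrite /descent /= lk Mk Ml eqxx.
  by congr scl; rewrite invfM mulrA divff ?mul1r.
- rewrite (@psi_step _ _ _ _ _ (pull _ _) _ k l); last first.
    by rewrite /descent /= !ffunE tpermL tpermR lk Mk Ml eqxx.
  rewrite !pull_tpermK !ffunE tpermL tpermR exch_unitarity ?adjacent_neq // sclA.
  congr scl; rewrite invfM mul1r mulrC -!mulrA; congr (_ * _).
  by rewrite mulrA divff ?mul1r.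
- rewrite (pull_tperm_eq (etrans Mk (esym Ml))) -psi_same ?Mk ?Ml //.
  by rewrite sclA mulrC.
Qed.

(** [exch] contains the permutation that R lacks, hence the transposed multi-index on the right. For
    x^2 v = w the denominator of R is [dd v w / (x * v)]. *)
Lemma RT_exch (k l : 'I_N) x v w g J : x != 0 -> x ^+ 2 * v = w -> v != 0 ->
  dd v w != 0 ->
  RT l k x g J = (dd v w)^-1 * yop k l v w g (pull (tperm k l) J).
Proof.
move=> x0 <- v0 d0; rewrite !ffunE tpermL tpermR pull_tpermK.
have e : hh * x - hh^-1 * x^-1 = dd v (x ^+ 2 * v) / (x * v).
  by rewrite /exch_den; field; rewrite x0 v0 hh0.
have [Jlk|Jlk] := eqVneq (J l) (J k); first by rewrite mulKf // pull_tperm_eq.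
rewrite tpermC e; move: d0; set d := dd _ _ => d0.
by case: ifP => _; rewrite /exch_cst; field; rewrite ?x0 ?v0 ?d0 ?hh0.
Qed.

(** [c m] is the site standing at place m: this is the flat solution with the sites lined up in the
    order [c], read as a functional in the original labelling. *)
Definition flat_at (c : 'I_N -> 'I_N) M u : fn :=
  [ffun J : idx => flat (pull c M) (pull c u) (pull c J)].

Lemma RT_flat_at (c : 'I_N -> 'I_N) M u (k l : 'I_N) x : injective c -> l = k.+1 :> nat ->
  generic u -> (forall i, u i != 0) -> x != 0 -> x ^+ 2 * u (c l) = u (c k) ->
  RT (c l) (c k) x (flat_at c M u) = flat_at (c \o tperm k l) M u.
Proof.
move=> cI lk gu u0 x0 xu; apply/ffunP => J.
have nlk : l != k by rewrite eq_sym adjacent_neq.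
have /and3P[_ d1 d2] : ok2 hh (u (c l)) (u (c k)) by apply: gu; rewrite (inj_eq cI).
have cJ : pull c (pull (tperm (c l) (c k)) J) = pull (tperm l k) (pull c J).
  by apply/ffunP => m; rewrite !ffunE !tperm_if !(inj_eq cI); do ![case: ifP].
have -> : RT (c l) (c k) x (flat_at c M u) J =
    RT l k x (flat (pull c M) (pull c u)) (pull c J).
  by rewrite /RT /flat_at !ffunE cJ.
rewrite (@RT_exch k l x _ _ _ (pull c J) x0 xu (u0 _) d1).
have h := @flat_swap (pull (c \o tperm k l) M) (pull (c \o tperm k l) u) k l lk.
rewrite !ffunE /= tpermL tpermR in h; move: (h d1 d2).
have E (T : Type) (f : {ffun 'I_N -> T}) : pull (tperm k l) (pull (c \o tperm k l) f) = pull c f.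
  by rewrite pull_pull; apply: eq_pull => m /=; rewrite tpermK.
rewrite !E => ->; rewrite ffunE mulKf // [RHS]ffunE; congr (flat _ _ _).
by rewrite pull_pull.
Qed.

(** The R-matrices to the left of the twist carry the site i from its own place to the first, one
    neighbour at a time. *)
Lemma chain_low (i : 'I_N) M u (x : 'I_N -> F) (p : 'I_N) : (p <= i)%N ->
  generic u -> (forall j, u j != 0) ->
  (forall j : 'I_N, (j < i)%N -> x j != 0 /\ x j ^+ 2 * u i = u j) ->
  foldl (fun g j => RT i j (x j) g) (flat_at (rot_site p i) M u)
    (rev [seq j : 'I_N <- enum 'I_N | (j < p)%N]) = flat_at (rot_site 0 i) M u.
Proof.
move=> + gu u0 xu; case: p => p pN /=; elim: p pN => [|p IHp] pN pi.
  by rewrite (eq_filter (a2 := pred0)) // filter_pred0.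
have pN' : (p < N)%N by apply: ltnW.
pose k := Ordinal pN'; pose l := Ordinal pN.
rewrite (@enum_filter_rcons _ _ (fun j : 'I_N => (j < p)%N) k) //=; last first.
  by move=> j; rewrite -val_eqE /= ltnS; lia.
rewrite rev_rcons /=.
have cl : rot_site p.+1 i l = i by apply: rot_site_at.
have ck : rot_site p.+1 i k = k.
  by apply: val_inj; rewrite /= val_rot_site // /rotn /=; do ![case: ifP]; lia.
have [xk xuk] := xu k pi.
have := @RT_flat_at (rot_site p.+1 i) M u k l (x k) (rot_site_inj pN) erefl gu u0 xk.
rewrite cl ck => /(_ xuk) ->.
have -> : flat_at (rot_site p.+1 i \o tperm k l) M u = flat_at (rot_site p i) M u.
  have h := @rot_site_tperm _ i k l erefl.
  by apply/ffunP => J; rewrite !ffunE !(eq_pull _ h).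
by apply: IHp; apply: ltnW.
Qed.

(** The R-matrices to the right of the twist bring the site i from the last place back to its
    own. *)
Lemma chain_high (i : 'I_N) M u (x : 'I_N -> F) (p : 'I_N) : (i <= p)%N ->
  generic u -> (forall j, u j != 0) ->
  (forall j : 'I_N, (i < j)%N -> x j != 0 /\ x j ^+ 2 * u i = u j) ->
  foldl (fun g j => RT i j (x j) g) (flat_at (rot_site p i) M u)
    (rev [seq j : 'I_N <- enum 'I_N | (i < j <= p)%N]) = flat M u.
Proof.
move=> + gu u0 xu; case: p => p pN /=; elim: p pN => [|p IHp] pN ip.
  have -> : [seq j : 'I_N <- enum 'I_N | (i < j <= 0)%N] = [::].
    by rewrite (eq_filter (a2 := pred0)) ?filter_pred0 // => j /=; lia.
  apply/ffunP => J; rewrite ffunE.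
  have e : rot_site 0 i =1 id.
    by move=> m; have := rot_site_id i m; move: ip; rewrite leqn0 => /eqP ->.
  by rewrite !(pull_id _ e).
have [ei|ne] := eqVneq (i : nat) p.+1.
  have -> : [seq j : 'I_N <- enum 'I_N | (i < j <= p.+1)%N] = [::].
    by rewrite (eq_filter (a2 := pred0)) ?filter_pred0 // => j /=; lia.
  apply/ffunP => J; rewrite ffunE.
  have e : rot_site p.+1 i =1 id by move=> m; rewrite -ei rot_site_id.
  by rewrite !(pull_id _ e).
have ip' : (i <= p)%N by lia.
have pN' : (p < N)%N by apply: ltnW.
pose k := Ordinal pN'; pose l := Ordinal pN.
rewrite (@enum_filter_rcons _ _ (fun j : 'I_N => (i < j <= p)%N) l) /=; first last.
- by move=> j; rewrite -val_eqE /=; lia.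
- by move=> j /andP[].
- by lia.
rewrite rev_rcons /=.
have cl : rot_site p.+1 i l = i by apply: rot_site_at.
have ck : rot_site p.+1 i k = l.
  by apply: val_inj; rewrite /= val_rot_site // /rotn /=; do ![case: ifP]; lia.
have il : (i < l)%N by rewrite /=; lia.
have [xk xuk] := xu l il.
have := @RT_flat_at (rot_site p.+1 i) M u k l (x l) (rot_site_inj pN) erefl gu u0 xk.
rewrite cl ck => /(_ xuk) ->.
have -> : flat_at (rot_site p.+1 i \o tperm k l) M u = flat_at (rot_site p i) M u.
  have h := @rot_site_tperm _ i k l erefl.
  by apply/ffunP => J; rewrite !ffunE !(eq_pull _ h).
exact: IHp.
Qed.

Section Rotate.
Variables o t : 'I_N.
Hypotheses (o0 : o = 0%N :> nat) (tN : t = N.-1 :> nat).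
Local Notation rho := (rot_site N.-1 o).

Definition rot_word M : word := [ffun m => (m == t) || M (rho m)].

(** Before the move [o] is the first of the unmarked sites, after it the last of the marked ones.
    This is the same position in the order behind [theta], so no inversion changes and only the
    twist of [o] is new. *)
Lemma base_rot M K : ~~ M o -> zeta (K o) * base M K = base (rot_word M) (pull rho K).
Proof.
move=> Mo; rewrite !ffunE mulrA; congr (_ * _).
  rewrite (reindex_inj (rho_inj (o := o))) /= (bigD1 t) //= (rho_last o0 tN) (negPf Mo) mul1r.
  rewrite [RHS](bigD1 t) //= !ffunE eqxx (rho_last o0 tN) /=; congr (_ * _).
  by apply: eq_bigr => m mt; rewrite !ffunE (negPf mt).
rewrite (big_pair_rot _ o0 tN (fun a b => hh ^+ theta (M a) (M b) (K a) (K b))) /=.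
apply: eq_bigr => -[a b] /= ab.
have at' : a != t by rewrite -val_eqE /= tN; have := ltn_ord b; lia.
rewrite !ffunE (negPf at') /=; case: (eqVneq b t) => [->|bt] //=.
rewrite (rho_last o0 tN) (negPf Mo).
by rewrite /theta /=; case: (M _).
Qed.

Lemma denom_rot M u u' : ~~ M o -> (forall m, m != t -> u' m = u (rho m)) ->
  denom M u = denom (rot_word M) u'.
Proof.
move=> Mo uu'.
rewrite /denom (big_pair_rot _ o0 tN (fun a b => if M a && ~~ M b then dd (u a) (u b) else 1)) /=.
apply: eq_bigr => -[a b] /= ab.
have at' : a != t by rewrite -val_eqE /= tN; have := ltn_ord b; lia.
rewrite !ffunE (negPf at') /=; case: (eqVneq b t) => [->|bt] //=.
  by rewrite (negPf Mo) andbF.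
by rewrite !uu'.
Qed.

(** The value of [u'] at [t] is left free: this is where q drops out. The descents of the two words
    correspond under the shift by one place, so the exchanges on both sides match. *)
Lemma psi_rot M u u' K : ~~ M o -> (forall m, m != t -> u' m = u (rho m)) ->
  zeta (K o) * psi M u K = psi (rot_word M) u' (pull rho K).
Proof.
have [b] := ubnP (minv M); elim: b M u u' K => // b IHb M u u' K lb Mo uu'.
have [[k l] dM|noD] := pickP (descent M); last first.
  rewrite !psi_base ?base_rot // => -[k l]; last by rewrite noD.
  apply/and3P => -[/= /eqP lk]; rewrite !ffunE negb_or => Mk /andP[lt Ml].
  have kt : k != t by rewrite -val_eqE /= tN; have := ltn_ord l; lia.
  rewrite (negPf kt) /= in Mk.
  have := noD (rho k, rho l); rewrite /descent /= Mk Ml !(rhoE o0 tN).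
  by rewrite (negPf kt) (negPf lt) lk eqxx.
have /and3P[/= /eqP lk Mk Ml] := dM.
have ko : k != o by apply: contraNneq Mo => <-.
have k0 : (0 < k)%N by move: ko; rewrite -val_eqE /= o0; lia.
have lt_k' : (k.-1 < N)%N by have := ltn_ord k; lia.
pose k' := Ordinal lt_k'; have kk' : k = k'.+1 :> nat by rewrite /= prednK.
have kt : k != t by rewrite -val_eqE /= tN; have := ltn_ord l; lia.
have k't : k' != t by rewrite -val_eqE /= tN; have := ltn_ord k; lia.
have rk : rho k = l by apply: val_inj; rewrite /= (rhoE o0 tN) (negPf kt) lk.
have rk' : rho k' = k by apply: val_inj; rewrite /= (rhoE o0 tN) (negPf k't) kk'.
have lo : l != o by rewrite -val_eqE /= o0; lia.
have rs m : rho (tperm k' k m) = tperm k l (rho m).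
  have e1 : (rho m == k) = (m == k') by rewrite -{1}rk' (inj_eq (rho_inj (o := o))).
  have e2 : (rho m == l) = (m == k) by rewrite -{1}rk (inj_eq (rho_inj (o := o))).
  by rewrite !tperm_if e1 e2; do ![case: ifP].
have st m : m != t -> tperm k' k m != t by move=> mt; rewrite tperm_if; do ![case: ifP].
have dM' : descent (rot_word M) (k', k).
  by rewrite /descent /= !ffunE rk rk' (negPf kt) (negPf k't) Mk Ml -kk' eqxx.
rewrite (psi_step hh zeta u dM) (psi_step hh zeta u' dM').
have mM := minv_swap lk Mk Ml.
have lt1 : (minv (pull (tperm k l) M) < b)%N by move: lb; rewrite mM ltnS.
have tko : tperm k l o = o by rewrite tpermD.
have eM : rot_word (pull (tperm k l) M) = pull (tperm k' k) (rot_word M).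
  apply/ffunP => m; rewrite !ffunE -rs; congr (_ || _).
  by rewrite -{2}(tpermD k't kt) (inj_eq perm_inj).
have IH K' : zeta (K' o) * psi (pull (tperm k l) M) (pull (tperm k l) u) K' =
    psi (pull (tperm k' k) (rot_word M)) (pull (tperm k' k) u') (pull rho K').
  rewrite -eM; apply: IHb => //; first by rewrite ffunE tko.
  by move=> m mt; rewrite !ffunE -rs uu' // st.
rewrite /exch !ffunE rk rk' !uu' // rk rk'.
have eK : pull (tperm k' k) (pull rho K) = pull rho (pull (tperm k l) K).
  by apply/ffunP => m; rewrite !ffunE rs.
rewrite eK -!IH !ffunE tko.
by case: (K k == K l); ring.
Qed.

Lemma flat_rot M u u' K : ~~ M o -> (forall m, m != t -> u' m = u (rho m)) ->
  zeta (K o) * flat M u K = flat (rot_word M) u' (pull rho K).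
Proof.
move=> Mo uu'; rewrite /flat ffunE mulrCA (psi_rot _ Mo uu').
by rewrite [RHS]ffunE (denom_rot Mo uu').
Qed.

End Rotate.

End Transport.

(** * The eigenfunction property *)

Section Eigenfunction.
Variables (F : numFieldType) (n N : nat) (hh q : F) (zeta : 'I_n -> F).
Hypotheses (hh0 : hh != 0) (q0 : q != 0).
Local Notation idx := (multi_index n N).
Local Notation fn := {ffun multi_index n N -> F}.
Local Notation word := {ffun 'I_N -> bool}.
Local Notation pt := (point F N).
Local Notation dd := (exch_den hh).
Local Notation pos := (@tRS_position F N).
Local Notation flat := (@flat F n N hh zeta).
Variables (D : pt -> Prop).
Hypothesis D_regular : regular_region hh q D.
Variable Phi : pt -> tensor F n N.
Hypothesis Phi_qKZ : qKZ_solution hh q zeta D Phi.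

Let eps : fn := [ffun J : idx => hh ^+ inversions J].

Lemma position_neq0 a i : D a -> pos a i != 0.
Proof.
by case: D_regular => a0 _ _ Da; rewrite ffunE invr_eq0 expf_neq0 // a0.
Qed.

Lemma generic_position a : D a -> generic hh (pos a).
Proof.
move=> Da; have [a0 ne _] := D_regular.
have H i j : i != j -> dd (pos a i) (pos a j) != 0.
  move=> ij; have [_ h] := ne a Da i j ij; apply: contraNneq h => e.
  have ai := a0 a Da i; have aj := a0 a Da j.
  rewrite -subr_eq0; have -> : hh ^+ 2 * a i ^+ 2 - a j ^+ 2 =
      dd (pos a i) (pos a j) * (hh * a i ^+ 2 * a j ^+ 2).
    by rewrite !ffunE /exch_den; field; rewrite hh0 ai aj.
  by rewrite e mul0r.
move=> i j ij; apply/and3P; split; [|exact: H|by apply: H; rewrite eq_sym].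
have [h _] := ne a Da i j ij; rewrite !ffunE; apply: contraNneq h => /invr_inj.
by move/eqP.
Qed.

Lemma flat_empty u : flat [ffun=> false] u = eps.
Proof.
apply/ffunP => J; rewrite ffunE psi_base => [|p]; last by rewrite /descent !ffunE andbF.
rewrite /denom big1 => [|p _]; last by rewrite !ffunE.
rewrite invr1 mul1r !ffunE big1 ?mul1r => [|m _]; last by rewrite ffunE.
by rewrite prodrXr; congr (hh ^+ _); apply: eq_bigr => p _; rewrite !ffunE.
Qed.

Lemma qKZ_step a (i : 'I_N) (M : word) : D a -> M i -> (forall j, M j -> (i <= j)%N) ->
  pairing (flat [ffun m => (m != i) && M m] (pos (qshift q [set i] a)))
    (Phi (qshift q [set i] a)) = pairing (flat M (pos a)) (Phi a).
Proof.
move=> Da Mi Mmin; have [a0 _ shiftD] := D_regular.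
set M1 := finfun _; have Da' := shiftD a Da i; set a' := qshift q [set i] a in Da' *.
have N0 : (0 < N)%N by apply: leq_ltn_trans (ltn_ord i).
have lt_t : (N.-1 < N)%N by rewrite prednK.
pose o := Ordinal N0; pose t := Ordinal lt_t.
have a'i : a' i = q * a i by rewrite ffunE inE eqxx.
have a'j j : j != i -> a' j = a j by move=> ji; rewrite ffunE inE (negPf ji).
rewrite (Phi_qKZ Da) /qKZ_op.
rewrite (@pairing_op_prod _ _ _ _ _ (fun j => RT hh i j (a i * q / a j))); last first.
  move=> j; rewrite mem_rev mem_filter => /andP[ji _] g v; apply: pairing_Rmat.
  by rewrite -val_eqE /=; lia.
rewrite pairing_Zmat.
rewrite (@pairing_op_prod _ _ _ _ _ (fun j => RT hh i j (a i / a j))); last first.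
  move=> j; rewrite mem_rev mem_filter => /andP[ji _] g v; apply: pairing_Rmat.
  by rewrite -val_eqE /=; lia.
congr pairing.
have -> : flat M1 (pos a') = flat_at hh zeta (rot_site i i) M1 (pos a').
  by apply/ffunP => J; rewrite [RHS]ffunE !(pull_id _ (rot_site_id i)).
rewrite (@chain_low _ _ _ _ zeta hh0 i M1 (pos a') (fun j => a i * q / a j) i) //; first last.
- move=> j ji; have nji : j != i by rewrite -val_eqE /=; lia.
  have ai := a0 a Da i; have aj := a0 a Da j; split.
    by rewrite mulf_neq0 ?invr_eq0 // mulf_neq0.
  by rewrite [pos _ _]ffunE [pos _ j]ffunE a'i a'j //; field; rewrite ai aj q0.
- by move=> j; apply: position_neq0.
- exact: generic_position.
have e J : pull (rot_site 0 i) J o = J i by rewrite ffunE rot_site_at.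
have cyc m : rot_site 0 i (rot_site N.-1 o m) = rot_site N.-1 i m.
  apply: val_inj; rewrite /= !val_rot_site // /rotn /=.
  by have := ltn_ord m; have := ltn_ord i; do ![case: ifP => /=]; lia.
have roti m : m != t -> rot_site N.-1 i m != i.
  move=> mt; have ti : rot_site N.-1 i t = i by apply: rot_site_at.
  by rewrite -{2}ti (inj_eq (rot_site_inj lt_t)).
(* The twist marks the site i, and its position passes from the shifted to the unshifted value. *)
have -> : ZT zeta i (flat_at hh zeta (rot_site 0 i) M1 (pos a')) =
    flat_at hh zeta (rot_site t i) M (pos a).
  apply/ffunP => J; rewrite [LHS]ffunE [X in _ * X]ffunE [RHS]ffunE -(e _ J).
  rewrite (@flat_rot _ _ _ _ zeta hh0 o t erefl erefl _ _ (pull (rot_site t i) (pos a))).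
  - congr (flat _ _ _); last by rewrite pull_pull; apply: eq_pull => m /=; rewrite cyc.
    apply/ffunP => m; rewrite !ffunE cyc; case: (eqVneq m t) => [->|mt] /=.
      by rewrite rot_site_at.
    by rewrite roti.
  - by rewrite !ffunE rot_site_at // eqxx.
  - by move=> m mt; rewrite !ffunE cyc in_set1 (negPf (roti _ mt)).
have -> : [seq j : 'I_N <- enum 'I_N | (i < j)%N] = [seq j : 'I_N <- enum 'I_N | (i < j <= t)%N].
  by apply: eq_filter => j /=; have := ltn_ord j; lia.
apply: (@chain_high _ _ _ _ zeta hh0 i M (pos a) (fun j => a i / a j) t).
- by rewrite /=; have := ltn_ord i; lia.
- exact: generic_position.
- by move=> j; apply: position_neq0.
- move=> j ij; have ai := a0 a Da i; have aj := a0 a Da j; split.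
    by rewrite mulf_neq0 ?invr_eq0.
  by rewrite !ffunE; field; rewrite ai aj.
Qed.

Lemma qKZ_shift (M : word) a : D a ->
  pairing eps (Phi (qshift q [set i | M i] a)) = pairing (flat M (pos a)) (Phi a).
Proof.
have [b] := ubnP #|[set i | M i]|; elim: b M a => // b IHb M a lb Da.
have [i0 Mi0|M0] := pickP (fun i => M i); last first.
  have -> : M = [ffun=> false] by apply/ffunP => i; rewrite ffunE M0.
  rewrite flat_empty; congr (pairing _ (Phi _)); apply/ffunP => i.
  by rewrite !(ffunE, inE).
case: (arg_minnP (fun i : 'I_N => nat_of_ord i) Mi0) => i Mi Mmin.
rewrite -(qKZ_step Da Mi Mmin) -IHb; first last.
- by case: D_regular => _ _ h; apply: h.
- move: lb; rewrite (cardsD1 i) inE Mi add1n ltnS; apply: leq_trans.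
  by rewrite ltnS; apply: subset_leq_card; apply/subsetP => j; rewrite !inE ffunE.
congr (pairing _ (Phi _)); apply/ffunP => j; rewrite !(ffunE, inE).
by case: (eqVneq j i) => [->|]; rewrite ?Mi.
Qed.

(* The coefficient of \prod_(M i) p_i in T_d, up to a power of hh. *)
Let coef (M : word) (u : pt) : F :=
  \prod_i \prod_j (if M i && ~~ M j then dd (u i) (u j) / (u j - u i) else 1).

Lemma coefE (M : word) (u : pt) : generic hh u -> coef M u = sig hh M u * denom hh M u / vand u.
Proof.
move=> gu; rewrite /coef prod_pairs; last by move=> i; case: (M i).
rewrite /sig /denom /vand -big_split -prodf_div; apply: eq_bigr => -[i j] /= ij.
have /and3P[ne _ _] : ok2 hh (u i) (u j) by apply: gu; rewrite -val_eqE /=; lia.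
have d0 : u j - u i != 0 by rewrite subr_eq0 eq_sym.
have d0' : u i - u j != 0 by rewrite subr_eq0.
rewrite /kap; case: (M i); case: (M j) => /=; rewrite ?mulr1 ?mul1r ?divff //.
by rewrite -[u j - u i]opprB invrN mulrNN.
Qed.

Lemma numer_flat d (u : pt) (J : idx) : generic hh u ->
  numer hh zeta d u J / vand u = \sum_(M : word | #|[set i | M i]| == d) coef M u * flat M u J.
Proof.
move=> gu; rewrite /numer sum_ffunE mulr_suml; apply: eq_bigr => M _.
rewrite coefE // /flat !ffunE.
have d0 : denom hh M u != 0.
  apply/prodf_neq0 => -[i j] /= ij; case: ifP => _; last exact: oner_neq0.
  by have /and3P[] : ok2 hh (u i) (u j) by apply: gu; rewrite -val_eqE /=; lia.
by have v0 := vand_neq0 gu; field; rewrite d0 v0.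
Qed.

(** At t = hh^-2 each numerator is hh^-1 times a value of [dd], up to the sign shared with the
    denominator, and there are |I| (N - |I|) pairs. *)
Lemma tRS_coef (I : {set 'I_N}) (u : pt) : generic hh u ->
  \prod_(i in I) \prod_(j in ~: I) (((hh ^+ 2)^-1 * u i - u j) / (u i - u j)) =
  hh^-1 ^+ (#|I| * (N - #|I|)) * coef [ffun i => i \in I] u.
Proof.
move=> gu; pose Y i j := dd (u i) (u j) / (u j - u i).
have -> : coef [ffun i => i \in I] u = \prod_(i in I) \prod_(j in ~: I) Y i j.
  rewrite /coef [RHS]big_mkcond; apply: eq_bigr => i _; case: ifP => iI.
    rewrite [RHS]big_mkcond; apply: eq_bigr => j _; rewrite !ffunE inE iI /=.
    by case: (j \in I).
  by rewrite big1 // => j _; rewrite !ffunE iI.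
have -> : hh^-1 ^+ (#|I| * (N - #|I|)) = \prod_(i in I) \prod_(j in ~: I) hh^-1.
  have -> : (N - #|I|)%N = #|~: I| by rewrite [RHS]cardsCs setCK card_ord.
  by under eq_bigr do rewrite prodr_const; rewrite prodr_const -exprM mulnC.
rewrite -big_split; apply: eq_bigr => i iI; rewrite -big_split; apply: eq_bigr => j.
rewrite inE => jI; have ij : i != j by apply: contraNneq jI => <-.
have /and3P[ne _ _] := gu i j ij; have d0 : u i - u j != 0 by rewrite subr_eq0.
have d0' : u j - u i != 0 by rewrite subr_eq0 eq_sym.
by rewrite /Y /exch_den /=; field; rewrite hh0 d0 d0'.
Qed.

(** The sign of the swapped Vandermonde product cancels the one in [numer_swap], so [Gam] satisfies
    the exchange relation without sign. At an ascent of J both sides contain the factor u_l - u_k,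
    and dividing by it leaves hh. *)
Lemma numer_const_exchange d (Gam : fn) :
  (forall u, generic hh u -> numer hh zeta d u = scl (vand u) Gam) ->
  forall (J : idx) (k l : 'I_N), l = k.+1 :> nat -> (J k < J l)%N ->
  Gam (pull (tperm k l) J) = hh * Gam J.
Proof.
move=> nG J k l lk Jkl; have [u [gu _]] := generic_ex N hh0 [::].
have gsu : generic hh (pull (tperm k l) u).
  by move=> i j ij; rewrite !ffunE; apply: gu; rewrite (inj_eq perm_inj).
have /ffunP/(_ J) := numer_swap zeta hh0 d u lk.
rewrite nG // nG // vand_swap // exchZ !sclA mulN1r opprK !ffunE.
have -> : (J k == J l) = false by rewrite -val_eqE /= ltn_eqF.
have -> : (J l < J k)%N = false by rewrite ltnNge (ltnW Jkl).
have kl := adjacent_neq lk; have /and3P[ne _ _] := gu k l kl.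
have v0 := vand_neq0 gu => e.
have d0 : u l - u k != 0 by rewrite subr_eq0 eq_sym.
have e2 : vand u * ((u l - u k) * Gam (pull (tperm k l) J)) =
    dd (u k) (u l) * vand u * Gam J - vand u * (exch_cst hh * u k * Gam J).
  by rewrite e; ring.
by apply: (mulfI d0); apply: (mulfI v0); rewrite e2 /exch_den /exch_cst; ring.
Qed.

Variable s : 'I_n -> nat.
Hypothesis Phi_weight : forall a, D a -> weight_space s (Phi a).

(** The multiplicities of a letter are compared as elements of the field, which is faithful in
    characteristic zero. *)
Lemma weight_support a (J : idx) : D a -> ~~ of_weight s J -> Phi a J = 0.
Proof.
move=> Da /forallPn[c ne]; have /ffunP/(_ J) := Phi_weight Da c.
rewrite sum_ffunE (eq_bigr (fun k => (J k == c)%:R * Phi a J)); last first.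
  move=> k _; rewrite ffunE; case: eqP => [e|]; rewrite ?mul0r // mul1r.
  by congr (Phi a _); apply/ffunP => m; rewrite ffunE; case: eqP => [->|].
rewrite -mulr_suml -natr_sum -big_mkcond.
rewrite sum1_card ffunE -[_ *: _]/((s c)%:R * Phi a J) => /eqP.
rewrite -subr_eq0 -mulrBl mulf_eq0 subr_eq0 eqr_nat => /orP[/eqP e|/eqP //].
by case/eqP: ne; rewrite -e; apply: eq_card => k; rewrite inE.
Qed.

Lemma Upsilon_inversions a : D a -> Upsilon hh s Phi a = pairing eps (Phi a).
Proof.
move=> Da; apply: eq_bigr => J _; rewrite /Ehbar sum_ffunE.
have scE (x : F) (w : tensor F n N) : (x *: w) J = x * w J by rewrite ffunE.
have [wJ|wJ] := boolP (of_weight s J); last by rewrite weight_support // !mulr0.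
congr (_ * _); rewrite (bigD1 J) //= scE !ffunE eqxx mulr1 ellE big1 ?addr0 //.
by move=> K /andP[_ KJ]; rewrite scE ffunE eq_sym (negPf KJ) mulr0.
Qed.

Lemma Upsilon_eigenfunction d : (d <= N)%N ->
  eigenfunction D (tRS_H hh q pos d) (Upsilon hh s Phi).
Proof.
move=> dN; have [Gam nG] := numer_const N zeta hh0 d.
have [E GamE] := exchange_weight s (numer_const_exchange nG).
(* The factors are the normalization of the Hamiltonian, the power of hh from [tRS_coef], and the
   ratio of [Gam] to [eps] on the weight space. *)
exists (hh ^+ d * hh^-1 ^+ (d * (N - d)) * E) => a Da.
have gu := generic_position Da; set u := pos a in gu *.
have shiftD (I : {set 'I_N}) : D (qshift q I a).
  have [_ _ h] := D_regular.
  have [b] := ubnP #|I|; elim: b I => // b IHb I lb.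
  have [->|/set0Pn[i iI]] := eqVneq I set0.
    by have -> : qshift q set0 a = a by apply/ffunP => j; rewrite ffunE inE.
  have -> : qshift q I a = qshift q [set i] (qshift q (I :\ i) a).
    by apply/ffunP => j; rewrite !(ffunE, inE); case: (eqVneq j i) => [->|] //=; rewrite iI.
  by apply/h/IHb; move: lb; rewrite (cardsD1 i) iI.
rewrite /tRS_H /tRS_T -!mulrA; congr (_ * _).
have -> : \sum_(I : {set 'I_N} | #|I| == d)
    (\prod_(i in I) \prod_(j in ~: I) (((hh ^+ 2)^-1 * u i - u j) / (u i - u j))) *
      Upsilon hh s Phi (qshift q I a) =
    hh^-1 ^+ (d * (N - d)) *
      \sum_(M : word | #|[set i | M i]| == d) coef M u * pairing (flat M u) (Phi a).
  rewrite mulr_sumr (reindex (fun M : word => [set i | M i])) /=; last first.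
    exists (fun I : {set 'I_N} => [ffun i => i \in I]) => [M _|I _].
      by apply/ffunP => i; rewrite ffunE inE.
    by apply/setP => i; rewrite inE ffunE.
  apply: eq_bigr => M /eqP dM; rewrite tRS_coef // dM Upsilon_inversions // qKZ_shift // -mulrA.
  congr (_ * (coef _ _ * _)); first by apply/ffunP => i; rewrite ffunE inE.
congr (_ * _).
have -> : \sum_(M : word | #|[set i | M i]| == d) coef M u * pairing (flat M u) (Phi a) =
    pairing Gam (Phi a).
  under eq_bigr do rewrite /pairing mulr_sumr.
  rewrite exchange_big; apply: eq_bigr => J _ /=.
  under eq_bigr do rewrite mulrA.
  rewrite -mulr_suml -numer_flat // nG // ffunE [X in X * _]mulrC mulKf //.
  exact: vand_neq0 gu.
rewrite Upsilon_inversions // /pairing mulr_sumr; apply: eq_bigr => J _.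
have [wJ|wJ] := boolP (of_weight s J); last by rewrite weight_support // !mulr0.
by rewrite GamE // ffunE [X in X * _]mulrC mulrA.
Qed.

End Eigenfunction.

Theorem theorem5p10 (R : realType) (n N : nat) (hh q : R[i])
    (hh_neq0 : hh != 0) (q_neq0 : q != 0)
    (zeta : 'I_n -> R[i]) (s : 'I_n -> nat)
    (D : point R[i] N -> Prop) (D_regular : regular_region hh q D)
    (Phi : point R[i] N -> tensor R[i] n N)
    (Phi_weight : forall a, D a -> weight_space s (Phi a))
    (Phi_qKZ : qKZ_solution hh q zeta D Phi) :
  (forall a, D a ->
     Upsilon hh s Phi a = \sum_(J : multi_index n N) hh ^+ ell J * Phi a J) /\
  (forall d : nat, (1 <= d <= N)%N ->
     eigenfunction D (tRS_H hh q (@tRS_position _ N) d) (Upsilon hh s Phi)).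
Proof.
split=> [a Da|d /andP[_ dN]]; last first.
  exact: (Upsilon_eigenfunction hh_neq0 q_neq0 D_regular Phi_qKZ Phi_weight dN).
rewrite (Upsilon_inversions hh Phi_weight Da).
by apply: eq_bigr => J _; rewrite ffunE ellE.
Qed.
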